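(* Let $\Gamma=\{g_1,\ldots,g_k\}$ be a finite collection of orientation preserving homeomorphisms of the circle $\mathbf S^1$ such that $\Gamma^{-1}=\{g_1^{-1},\ldots,g_k^{-1}\}$ acts minimally on $\mathbf S^1$, and let $\mathbf p=(p_1,\ldots,p_k)$ be a probability distribution on $\{1,\ldots,k\}$ with all $p_i>0$. Then the Markov operator $P$ corresponding to the iterated function system $(\Gamma,\mathbf p)$ satisfies the e-property. Moreover, $P$ admits a unique invariant probability measure.
   Context: $\mathbf S^1$ is the circle; the distance $d(x,y)$ is the length of the shorter of the two arcs joining $x$ and $y$. A finite family $\{h_1,\ldots,h_k\}$ of homeomorphisms of $\mathbf S^1$ acts minimally if for every $x\in\mathbf S^1$ the orbit $\{h_{i_n}\circ\cdots\circ h_{i_1}(x): n\ge 1,\ (i_1,\ldots,i_n)\in\{1,\ldots,k\}^n\}$ is dense in $\mathbf S^1$ (only forward compositions are used); equivalently, the only closed sets $A\subset\mathbf S^1$ with $h_i(A)\subset A$ for all $i$ are $\emptyset$ and $\mathbf S^1$. The Markov operator corresponding to $(\Gamma,\mathbf p)$ acts on finite Borel measures $\mu$ on $\mathbf S^1$ by $P\mu=\sum_{i=1}^k p_i\,\mu\circ g_i^{-1}$, where $(\mu\circ g_i^{-1})(A)=\mu(g_i^{-1}(A))$. Its dual operator on $C(\mathbf S^1)$ is $Uf(x)=\sum_{i=1}^k p_i f(g_i(x))$. A measure $\mu$ is invariant if $P\mu=\mu$. The operator $P$ satisfies the e-property if for every $x\in\mathbf S^1$ and every Lipschitz function $f:\mathbf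 S^1\to\mathbb R$ one has $\lim_{y\to x}\sup_{n\in\mathbb N}|U^nf(y)-U^nf(x)|=0$. *)

(* Defs.v *)
From HB Require Import structures.
From mathcomp Require Import all_boot all_order all_algebra.
From mathcomp Require Import all_classical all_reals all_analysis.
From mathcomp Require Import lra.

Set Implicit Arguments.
Unset Strict Implicit.
Unset Printing Implicit Defensive.

Import Order.TTheory GRing.Theory Num.Theory.
Import numFieldNormedType.Exports.

Local Open Scope classical_set_scope.
Local Open Scope ring_scope.

(* The circle is R/Z, each class being represented by its element in [0, 1);
   its total length is 1. *)
Record circle (R : realType) := Circle {
  circle_val : R ;
  circle_valP : 0 <= circle_val < 1 }.

HB.instance Definition _ (R : realType) := [isSub for @circle_val R].
HB.instance Definition _ (R : realType) := [Choice of circle R by <:].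

Section Circle.
Variable R : realType.
Implicit Types x y z : circle R.

Lemma fracpart_itv (t : R) : 0 <= t - (Num.floor t)%:~R < 1.
Proof. by rewrite subr_ge0 ltrBlDl floor_le -intrD1 floorD1_gt. Qed.

Definition circle_proj (t : R) : circle R :=
  Circle (fracpart_itv t).

(* The two arcs joining x and y have lengths |x - y| and 1 - |x - y|. *)
Definition arc_dist x y : R :=
  Num.min `|circle_val x - circle_val y| (1 - `|circle_val x - circle_val y|).

Lemma arc_distxx x : arc_dist x x = 0.
Proof. by rewrite /arc_dist subrr normr0 subr0 minEle ler01. Qed.

Lemma arc_dist_positivity x y : arc_dist x y = 0 -> x = y.
Proof.
move=> d0; apply: val_inj; move: d0; rewrite /arc_dist.
case: x y => [x /= /andP[? ?]] [y /= /andP[? ?]].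
by case: (lerP x y) => ?; case: lerP => ? ?; lra.
Qed.

Lemma arc_dist_sym x y : arc_dist x y = arc_dist y x.
Proof. by rewrite /arc_dist distrC. Qed.

Lemma arc_dist_triangle y x z : arc_dist x z <= arc_dist x y + arc_dist y z.
Proof.
rewrite /arc_dist.
case: x y z => [x /= /andP[? ?]] [y /= /andP[? ?]] [z /= /andP[? ?]].
rewrite !minEle.
by case: (lerP x y) => ?; case: (lerP y z) => ?; case: (lerP x z) => ?;
   do 3![case: ifPn; rewrite -?ltNge => ?]; lra.
Qed.

HB.instance Definition _ := isMetric.Build R (circle R)
  arc_distxx arc_dist_positivity arc_dist_sym arc_dist_triangle.

HB.instance Definition _ := isPointed.Build (circle R) (circle_proj 0).

(* The measurable sets are the Borel sets. *)
HB.instance Definition _ :=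
  Measurable.copy (circle R) (g_sigma_algebraType (@open (circle R))).

End Circle.

Record homeo (T : topologicalType) := Homeo {
  homeo_fun :> T -> T ;
  homeo_inv : T -> T ;
  homeo_funK : cancel homeo_fun homeo_inv ;
  homeo_invK : cancel homeo_inv homeo_fun ;
  homeo_fun_continuous : continuous homeo_fun ;
  homeo_inv_continuous : continuous homeo_inv }.

(* h preserves orientation when it has an increasing lift to the line. *)
Definition orientation_preserving (R : realType) (h : circle R -> circle R) :=
  exists F : R -> R,
    [/\ continuous F,
        {homo F : s t / s < t},
        forall t, F (t + 1) = F t + 1 &
        forall t, h (circle_proj t) = circle_proj (F t)].

Definition forward_orbit (T : Type) (k : nat) (h : 'I_k -> T -> T) (x : T) :
    set T :=
  [set y | exists2 w : seq 'I_k, w != [::] & y = foldl (fun z i => h i z) x w].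

Definition acts_minimally (T : topologicalType) (k : nat)
    (h : 'I_k -> T -> T) :=
  forall x : T, dense (forward_orbit h x).

Definition markov_op (d : measure_display) (T : measurableType d)
    (R : realType) (k : nat) (p : 'I_k -> R) (g : 'I_k -> T -> T)
    (mu : set T -> \bar R) : set T -> \bar R :=
  fun A => (\sum_(i < k) (p i)%:E * pushforward mu (g i) A)%E.

Definition dual_op (T : Type) (R : realType) (k : nat) (p : 'I_k -> R)
    (g : 'I_k -> T -> T) (f : T -> R) : T -> R :=
  fun x => \sum_(i < k) p i * f (g i x).

(* Set functions are only compared on measurable sets: the value of a measure
   elsewhere is meaningless. *)
Definition invariant_measure (d : measure_display) (T : measurableType d)
    (R : realType) (k : nat) (p : 'I_k -> R) (g : 'I_k -> T -> T)
    (mu : set T -> \bar R) :=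
  forall A, measurable A -> markov_op p g mu A = mu A.

Definition is_lipschitz (R : realType) (T : metricType R) (f : T -> R) :=
  exists L : R, forall x y, `|f x - f y| <= L * mdist x y.

Definition e_property (R : realType) (T : metricType R) (k : nat)
    (p : 'I_k -> R) (g : 'I_k -> T -> T) :=
  forall (x : T) (f : T -> R), is_lipschitz f ->
    ereal_sup (range (fun n : nat =>
      `|iter n (dual_op p g) f y - iter n (dual_op p g) f x|%:E)) @[y --> x]
    --> 0%E.

(* Main.v *)
Require Import Defs.
From HB Require Import structures.
From mathcomp Require Import all_boot all_order all_algebra.
From mathcomp Require Import all_classical all_reals all_analysis.
From mathcomp Require Import finmap measurable_realfun lra ring.

(** The argument lifts the circle to the line and replaces measures by their
    distribution functions. A distribution function of a finitely additive
    probability on the circle is a nondecreasing G : R -> R of degree one, that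
    is, G (t + 1) = G t + 1. Let F_i be an increasing lift of g_i and K_i its
    inverse. The operator that sends a function A to t |-> sum_i p_i A (F_i t),
    iterated from the identity, produces functions whose Banach limit, once they
    are normalized at 0, is a G with stationary increments:
      sum_i p_i (G (F_i t) - G (F_i s)) = G t - G s   ([exists_stationary]).
    Such a G is the distribution function of a stationary measure of the
    inverse system, and minimality of the inverse system makes it a
    homeomorphism of the line:
    - G is continuous ([stationary_continuous]): if it had a jump, the points
      where the jump is largest would be finitely many and form a forward
      invariant set of the circle; as an injection of a finite set into itself
      is onto, this set would contain a whole orbit of the inverse system, which
      is infinite;
    - G is strictly increasing ([stationary_lt]): the set of points around which
      G grows is backward invariant and not empty, hence dense.

    The gap G t - G s is then an exact martingale for the random motion of the
    arc from s to t. A Lipschitz f satisfies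
      |f (pi t) - f (pi s)| <= e + B (G t - G s)   for s <= t,
    where pi is the projection of the line onto the circle, and this bound is
    preserved by the dual operator U ([dual_iter_gap]); continuity of G turns it
    into equicontinuity of the iterates U^n f, which is the e-property.

    For uniqueness, a continuous h with U h = h is constant
    ([harmonic_constant]): otherwise, among the arcs that start at a maximum of
    h and end at a minimum, those of least gap form a finite forward invariant
    family, since the average of the gap is preserved. The Banach limit of
    n |-> U^n f x is continuous in x and fixed by U, hence a constant c, and
    compactness shows that Cesaro means of U^n f come uniformly close to c. So
    the integral of f is c for every invariant probability, and integrals of
    Lipschitz functions determine a measure ([lipschitz_integral_eq]).

    For existence, the same construction applied to the inverse lifts K_i gives
    a continuous H of degree one with increments stationary for the K_i. Its
    Stieltjes measure, cut to ]0, 1] and projected to the circle, is an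
    invariant probability ([exists_invariant_measure]). *)

Set Implicit Arguments.
Unset Strict Implicit.
Unset Printing Implicit Defensive.

Import Order.TTheory GRing.Theory Num.Theory.
Import numFieldNormedType.Exports.

Local Open Scope classical_set_scope.
Local Open Scope ring_scope.

(** * Banach limits of bounded sequences *)

Section BanachLimit.
Variable R : realType.
Implicit Types u v : nat -> R.

Definition bounded_seq u := exists B, forall n, `|u n| <= B.

Definition cesaro u : nat -> R := fun n => n.+1%:R^-1 * \sum_(j < n.+1) u j.

Lemma free_ultrafilter : exists U : set_system nat, UltraFilter U /\ \oo `<=` U.
Proof. exact: ultraFilterLemma. Qed.

Definition nat_ultra : set_system nat := projT1 (cid free_ultrafilter).

Instance nat_ultra_ultra : UltraFilter nat_ultra.
Proof. exact: (projT2 (cid free_ultrafilter)).1. Qed.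

Lemma sub_nat_ultra : \oo `<=` nat_ultra.
Proof. exact: (projT2 (cid free_ultrafilter)).2. Qed.

(** The ultrafilter makes the limit exist for every bounded sequence; taking it
    along the Cesaro means makes it invariant under the shift. *)
Definition banach_lim u : R := lim (cesaro u @ nat_ultra).

Lemma ultra_fmap (T : Type) (u : nat -> T) : UltraFilter (u @ nat_ultra).
Proof.
split=> [|G GP sG]; first exact: fmap_proper_filter.
rewrite predeqE => A; split=> [GA|]; last exact: sG.
have [//|nA] := in_ultra_setVsetC (u @^-1` A) nat_ultra_ultra.
have /filter_ex [x [//]] : G (A `&` ~` A) by apply: filterI => //; exact: sG.
Qed.

Lemma is_cvg_nat_ultra u : bounded_seq u -> cvg (u @ nat_ultra).
Proof.
move=> [B uB].
have := @segment_compact R (- B) B.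
rewrite compact_ultra => /(_ (u @ nat_ultra) (ultra_fmap u)).
case=> [|l [_ ul]]; last by apply/cvg_ex; exists l.
by rewrite /fmap /=; apply: filterE => n; rewrite /= in_itv /= -ler_norml.
Qed.

Lemma bounded_cesaro u : bounded_seq u -> bounded_seq (cesaro u).
Proof.
move=> [B uB]; exists B => n; rewrite /cesaro normrM ger0_norm ?invr_ge0//.
rewrite mulrC ler_pdivrMr ?ltr0n// (le_trans (ler_norm_sum _ _ _))//.
rewrite (@le_trans _ _ (\sum_(i < n.+1) B)) ?ler_sum//.
by rewrite sumr_const card_ord mulr_natr.
Qed.

Lemma is_cvg_cesaro u : bounded_seq u -> cvg (cesaro u @ nat_ultra).
Proof. by move/bounded_cesaro/is_cvg_nat_ultra. Qed.

Lemma bounded_lin a u v : bounded_seq u -> bounded_seq v ->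
  bounded_seq (fun n => a * u n + v n).
Proof.
move=> [B uB] [C vC]; exists (`|a| * B + C) => n.
by rewrite (le_trans (ler_normD _ _))// lerD// normrM ler_wpM2l.
Qed.

Lemma bounded_cst a : bounded_seq (fun=> a).
Proof. by exists `|a|. Qed.

Lemma bounded_sum (I : Type) (r : seq I) (a : I -> R) (w : I -> nat -> R) :
  (forall i, bounded_seq (w i)) -> bounded_seq (fun n => \sum_(i <- r) a i * w i n).
Proof.
move=> wB; elim: r => [|i r IH].
  by exists 0 => n; rewrite big_nil normr0.
under eq_fun do rewrite big_cons.
exact: bounded_lin.
Qed.

Lemma banach_lim_lin a u v : bounded_seq u -> bounded_seq v ->
  banach_lim (fun n => a * u n + v n) = a * banach_lim u + banach_lim v.
Proof.
move=> bu bv; apply: cvg_lim => //.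
have -> : cesaro (fun n => a * u n + v n) =
          (fun n => a * cesaro u n + cesaro v n).
  apply/funext => n; rewrite /cesaro big_split /= -mulr_sumr mulrDr.
  by rewrite mulrCA.
by apply: cvgD; [apply: cvgMr|]; exact: is_cvg_cesaro.
Qed.

Lemma banach_lim_cst a : banach_lim (fun=> a) = a.
Proof.
apply: cvg_lim => //.
rewrite (_ : cesaro _ = fun=> a); first exact: cvg_cst.
apply/funext => n; rewrite /cesaro sumr_const card_ord -[a *+ _]mulr_natl mulrA.
by rewrite mulVf ?mul1r// pnatr_eq0.
Qed.

Lemma banach_lim_sum (I : Type) (r : seq I) (a : I -> R) (w : I -> nat -> R) :
  (forall i, bounded_seq (w i)) ->
  banach_lim (fun n => \sum_(i <- r) a i * w i n) =
  \sum_(i <- r) a i * banach_lim (w i).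
Proof.
move=> wB; elim: r => [|i r IH].
  by under eq_fun do rewrite big_nil; rewrite banach_lim_cst big_nil.
under eq_fun do rewrite big_cons.
by rewrite banach_lim_lin ?IH ?big_cons//; exact: bounded_sum.
Qed.

Lemma ler_banach_lim u v : bounded_seq u -> bounded_seq v ->
  (forall n, u n <= v n) -> banach_lim u <= banach_lim v.
Proof.
move=> bu bv uv; apply: ler_lim; [exact: is_cvg_cesaro..|].
apply: filterE => n; rewrite /cesaro ler_wpM2l ?invr_ge0//.
exact: ler_sum.
Qed.

(** The Cesaro means of u and of its shift at rank n differ by
    (u (n + 1) - u 0) / (n + 1), which tends to 0. *)
Lemma banach_lim_shift u : bounded_seq u ->
  banach_lim (fun n => u n.+1) = banach_lim u.
Proof.
move=> bu; have [B uB] := bu; apply: cvg_lim => //.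
have -> : cesaro (fun n => u n.+1) =
          (fun n => n.+1%:R^-1 * (u n.+1 - u 0%N) + cesaro u n).
  apply/funext => n; rewrite /cesaro -mulrDr; congr (_ * _).
  have : u 0%N + \sum_(j < n.+1) u j.+1 = \sum_(j < n.+1) u j + u n.+1.
    by rewrite -(big_ord_recl n.+1 (fun j => u j)) big_ord_recr.
  lra.
rewrite -[banach_lim u]add0r; apply: cvgD; last exact: is_cvg_cesaro.
suff : (fun n => n.+1%:R^-1 * (u n.+1 - u 0%N)) @ \oo --> (0 : R).
  by move=> h; apply: cvg_trans h => A; exact: sub_nat_ultra.
apply/cvgr0Pnorm_le => e e0.
have h : (@GRing.inv R \o (fun n => n.+1%:R)) @ \oo --> (0 : R) by exact: cvg_harmonic.
have B0 : 0 <= B by exact: le_trans (uB 0%N).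
have d0 : 0 < e / (2 * B + 1) by rewrite divr_gt0//; lra.
move/cvgr0Pnorm_le : h => /(_ _ d0); apply: filterS => n /= h.
rewrite normrM (@le_trans _ _ (e / (2 * B + 1) * (2 * B + 1)))//.
  apply: ler_pM => //; rewrite (le_trans (ler_normB _ _))//.
  by have := uB n.+1; have := uB 0%N; lra.
by rewrite mulfVK//; lra.
Qed.

Lemma banach_lim_dist u v e : bounded_seq u -> bounded_seq v ->
  (forall n, `|u n - v n| <= e) -> `|banach_lim u - banach_lim v| <= e.
Proof.
move=> bu bv uv.
have shift w w' : bounded_seq w -> bounded_seq w' -> (forall n, w n <= w' n + e) ->
    banach_lim w <= banach_lim w' + e.
  move=> bw bw' ww'; rewrite -[X in _ <= _ + X]banach_lim_cst -[X in _ <= X + _]mul1r.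
  rewrite -banach_lim_lin//; last exact: bounded_cst.
  apply: ler_banach_lim => // [|n]; last by rewrite mul1r.
  by apply: bounded_lin => //; exact: bounded_cst.
have uv1 := shift u v bu bv; have vu1 := shift v u bv bu.
rewrite ler_norml; apply/andP; split.
  suff : banach_lim v <= banach_lim u + e by lra.
  by apply: vu1 => n; have := uv n; rewrite ler_norml => /andP[? ?]; lra.
suff : banach_lim u <= banach_lim v + e by lra.
by apply: uv1 => n; have := uv n; rewrite ler_norml => /andP[? ?]; lra.
Qed.

(** A filter is closed under finite intersections, so that one rank serves
    finitely many sequences. This is how generalized limits lead back to
    genuine means. *)
Lemma banach_lim_approx (I : eqType) (s : seq I) (w : I -> nat -> R) e : 0 < e ->
  (forall i, bounded_seq (w i)) ->
  exists n, forall i, i \in s -> `|cesaro (w i) n - banach_lim (w i)| <= e.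
Proof.
move=> e0 wB; suff : nat_ultra [set n | forall i, i \in s ->
    `|cesaro (w i) n - banach_lim (w i)| <= e] by move/filter_ex.
elim: s => [|i s IH]; first by apply: filterE.
have wi : cesaro (w i) @ nat_ultra --> banach_lim (w i) by exact: is_cvg_cesaro.
have /cvgrPdist_le /(_ _ e0) wie := wi.
apply: filterS2 IH wie => n IH wie j.
by rewrite inE => /orP[/eqP ->|/IH //]; rewrite distrC.
Qed.

End BanachLimit.

(** * The projection of the line onto the circle *)

Section CircleProjection.
Variable R : realType.
Implicit Types (s t : R) (x y : circle R) (n : int).

Lemma floor_eq0 t : 0 <= t < 1 -> Num.floor t = 0.
Proof. by move=> t01; apply: floor_def; rewrite add0r. Qed.

Lemma circle_valK : cancel (@circle_val R) (@circle_proj R).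
Proof.
move=> x; apply: val_inj => /=; have := circle_valP x.
by move=> /floor_eq0 ->; rewrite subr0.
Qed.

Lemma circle_projDz t n : circle_proj (t + n%:~R) = circle_proj t.
Proof.
by apply: val_inj => /=; rewrite floorDrz// intrKfloor intrD; lra.
Qed.

Lemma circle_proj_eq s t :
  circle_proj s = circle_proj t -> exists n, t = s + n%:~R.
Proof.
move=> /(congr1 (@circle_val R)) /= st.
by exists (Num.floor t - Num.floor s); rewrite intrB; lra.
Qed.

Lemma circle_val_itv x : 0 <= circle_val x < 1.
Proof. exact: circle_valP. Qed.

Lemma mdist_circle_proj s t :
  mdist (circle_proj s) (circle_proj t) <= `|s - t|.
Proof.
rewrite /mdist /= /arc_dist /=.
have := fracpart_itv s; have := fracpart_itv t.
move: (Num.floor s) (Num.floor t) => m n.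
have -> : s - t = (s - m%:~R - (t - n%:~R)) + (m - n)%:~R by rewrite intrB; lra.
move: (s - _) (t - _) (m - n) => a b k /andP[b0 b1] /andP[a0 a1].
have [->|k0] := eqVneq k 0; first by rewrite addr0 ge_min lexx.
rewrite ge_min; apply/orP; right.
have k1 : 1 <= `|k%:~R : R| by rewrite -intr_norm ler1z -gtz0_ge1 normr_gt0.
have ke : a - b + k%:~R - (a - b) = k%:~R by lra.
by have := ler_normB (a - b + k%:~R) (a - b); rewrite ke => kab; lra.
Qed.

(** The shorter of the two arcs from x to y lifts to a segment starting at the
    representative of x: its end is the representative of y, possibly moved by
    one turn. *)
Lemma circle_lift_near x y :
  exists2 t, circle_proj t = y & `|circle_val x - t| <= mdist x y.
Proof.
rewrite /mdist /= /arc_dist.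
have /andP[x0 x1] := circle_val_itv x; have /andP[y0 y1] := circle_val_itv y.
have [|] := leP `|circle_val x - circle_val y| (1 - `|circle_val x - circle_val y|).
  by exists (circle_val y) => //; exact: circle_valK.
move=> _; case: (lerP (circle_val x) (circle_val y)) => xy.
  exists (circle_val y + (-1)%:~R); first by rewrite circle_projDz circle_valK.
  by rewrite ler_norml; apply/andP; split; lra.
exists (circle_val y + 1%:~R); first by rewrite circle_projDz circle_valK.
by rewrite ler_norml; apply/andP; split; lra.
Qed.

Lemma mdist_circle_le1 x y : mdist x y <= 1.
Proof.
rewrite -(circle_valK x) -(circle_valK y) (le_trans (mdist_circle_proj _ _))//.
have /andP[x0 x1] := circle_val_itv x; have /andP[y0 y1] := circle_val_itv y.
by rewrite ler_norml; apply/andP; split; lra.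
Qed.

Lemma circle_proj_continuous : continuous (@circle_proj R : R -> circle R).
Proof.
move=> t; apply/cvg_ballP => e e0; near=> s.
rewrite ballEmdist /=; apply: (le_lt_trans (mdist_circle_proj _ _)).
by near: s; apply: cvgr_dist_lt.
Unshelve. all: by end_near. Qed.

Lemma infinite_circle : infinite_set [set: circle R].
Proof.
pose h (n : nat) := circle_proj (n.+1%:R^-1 / 2 : R).
have hI : injective h.
  move=> m n /(congr1 (@circle_val R)) /=.
  have fl (j : nat) : Num.floor (j.+1%:R^-1 / 2 : R) = 0.
    have : (j.+1%:R^-1 : R) <= 1 by rewrite invf_le1 ?ler1n ?ltr0n.
    have : 0 < (j.+1%:R^-1 : R) by rewrite invr_gt0 ltr0n.
    by move: j.+1%:R^-1 => z z0 z1; apply: floor_eq0; apply/andP; split; lra.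
  rewrite !fl !subr0 => e.
  have {}e : (m.+1%:R^-1 : R) = n.+1%:R^-1.
    by move: e; move: m.+1%:R^-1 n.+1%:R^-1 => a b; lra.
  by have /eqP := invr_inj e; rewrite eqr_nat => /eqP [].
move=> finC; apply: infinite_nat.
by rewrite -(preimage_setT h); apply: finite_preimage => // m n _ _ /hI.
Qed.

End CircleProjection.

(** * Finite invariant sets and stationary functions of degree one *)

Section FiniteOrbits.
Variables (R : realType) (k : nat) (g : 'I_k -> homeo (circle R)).
Hypothesis ginv_minimal : acts_minimally (fun i => homeo_inv (g i)).

(** A nonempty such set contains an orbit of the inverse system, hence is dense;
    being closed, it is the whole circle, which is infinite. *)
Lemma finite_backward_invariant_eq0 (E : set (circle R)) : finite_set E ->
  (forall i x, E x -> E (homeo_inv (g i) x)) -> E = set0.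
Proof.
move=> finE Einv; rewrite -subset0 => x Ex.
have orbE : forward_orbit (fun i => homeo_inv (g i)) x `<=` E.
  move=> _ [w _ ->]; elim: w x Ex => [|i w IH] y Ey //=.
  by apply: IH; exact: Einv.
have openE : open (~` E).
  have T1 := hausdorff_accessible (@metric_hausdorff _ (circle R)).
  by apply: closed_openC; move: finE; apply: accessible_finite_set_closed.1.
have [|y [nEy /orbE //]] := ginv_minimal x _ openE.
apply/set0P; apply/eqP => E0; apply: (@infinite_circle R).
by rewrite -(setCK setT) setCT -E0 setCK.
Qed.

Lemma finite_injS_surj (T : choiceType) (E : set T) (f : T -> T) :
  finite_set E -> injective f -> (forall x, E x -> E (f x)) ->
  forall y, E y -> exists2 x, E x & f x = y.
Proof.
move=> finE fI fE y Ey.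
have sub : ([fset f x | x in fset_set E] `<=` fset_set E)%fset.
  apply/fsubsetP => _ /imfsetP [x /= xE ->].
  by move: xE; rewrite !in_fset_set// => /set_mem Ex; exact/mem_set/fE.
have : (y \in [fset f x | x in fset_set E])%fset.
  suff -> : ([fset f x | x in fset_set E] = fset_set E)%fset.
    by rewrite in_fset_set//; exact: mem_set.
  by apply/eqP; rewrite eqEfcard sub card_imfset//= leqnn.
by case/imfsetP => x /=; rewrite in_fset_set// => /set_mem Ex ->; exists x.
Qed.

(** An injection of a finite set into itself is onto, so that finite forward
    invariant sets are backward invariant. *)
Lemma finite_forward_invariant_eq0 (E : set (circle R)) : finite_set E ->
  (forall i x, E x -> E (g i x)) -> E = set0.
Proof.
move=> finE Einv; apply: finite_backward_invariant_eq0 => // i y Ey.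
have [x Ex <-] := finite_injS_surj finE (can_inj (@homeo_funK _ (g i))) (Einv i) Ey.
by rewrite homeo_funK.
Qed.

End FiniteOrbits.

Section DegreeOne.
Variable R : realType.
Implicit Types (F G : R -> R) (s t : R).

Definition degree_one G := forall t, G (t + 1) = G t + 1.

Lemma degree_oneDz G : degree_one G -> forall t (n : int), G (t + n%:~R) = G t + n%:~R.
Proof.
move=> G1.
have Gn (n : nat) t : G (t + n%:R) = G t + n%:R.
  elim: n => [|n IH]; first by rewrite !addr0.
  by rewrite -natr1 !addrA G1 IH.
move=> t [n|n]; first exact: Gn.
by rewrite NegzE mulrNz -[in RHS](subrK (n.+1%:R) t) Gn addrK.
Qed.

(** At integer distance G moves exactly as its argument, and t lies between two
    consecutive integers. *)
Lemma degree_one_near G : {homo G : s t / s <= t} -> degree_one G ->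
  forall t, `|G t - G 0| <= `|t| + 1.
Proof.
move=> Gle G1 t.
have fl : (Num.floor t)%:~R <= t by exact: floor_le.
have fl1 : t < (Num.floor t)%:~R + 1 by rewrite -intrD1 floorD1_gt.
have := degree_oneDz G1 0 (Num.floor t); rewrite add0r => Gfl.
have := Gle _ _ fl; have := Gle _ _ (ltW fl1); rewrite G1 Gfl => ub lb.
rewrite ler_norml; have := ler_norm t; have := ler_norm (- t); rewrite normrN.
by move=> *; apply/andP; split; lra.
Qed.

End DegreeOne.

Section Stationary.
Variables (R : realType) (k : nat) (p : 'I_k -> R) (F : 'I_k -> R -> R).

(** The increment G t - G s is the mass of the arc from s to t for the measure
    with distribution function G; only increments are constrained because G is
    defined up to an additive constant. *)
Definition stationary (G : R -> R) :=
  forall s t, \sum_(i < k) p i * (G (F i t) - G (F i s)) = G t - G s.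

Hypothesis p_ge0 : forall i, 0 <= p i.
Hypothesis p_sum1 : \sum_(i < k) p i = 1.
Hypothesis F_le : forall i, {homo F i : s t / s <= t}.
Hypothesis F_degree : forall i, degree_one (F i).

Let T := dual_op p F.
Let A j := iter j T id.

Let A_le j : {homo A j : s t / s <= t}.
Proof.
elim: j => [//|j IH] s t st; apply: ler_sum => i _.
by rewrite ler_wpM2l//; apply/IH/F_le.
Qed.

Let A_degree j : degree_one (A j).
Proof.
elim: j => [//|j IH] t.
rewrite -[A j.+1]/(T (A j)) /T /dual_op -[X in _ = _ + X]p_sum1 -big_split /=.
by apply: eq_bigr => i _; rewrite F_degree IH; ring.
Qed.

Let D j t := A j t - A j 0.

Let bounded_D t : bounded_seq (fun j => D j t).
Proof. by exists (`|t| + 1) => j; exact: degree_one_near. Qed.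

(** The Banach limit of the normalized iterates D j t = A j t - A j 0, which are
    bounded in j because the A j are nondecreasing of degree one. One more step of
    averaging turns D j into D (j + 1) up to a term that depends on j only, and
    the Banach limit ignores the shift. *)
Lemma exists_stationary : exists G,
  [/\ {homo G : s t / s <= t}, degree_one G & stationary G].
Proof.
pose G t := banach_lim (fun j => D j t).
exists G; split.
- by move=> s t st; apply: ler_banach_lim => // j; rewrite lerD2r A_le.
- move=> t; rewrite /G -[X in _ = _ + X](banach_lim_cst 1) -[X in _ = X + _]mul1r.
  rewrite -banach_lim_lin//; last exact: bounded_cst.
  by congr banach_lim; apply/funext => j; rewrite /D A_degree; ring.
(* The correction term does not depend on t: it cancels in increments. *)
have step t : \sum_(i < k) p i * G (F i t) =
    G t + banach_lim (fun j => A j.+1 0 - A j 0).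
  rewrite /G -banach_lim_sum// -(banach_lim_shift (bounded_D t)).
  rewrite -[X in _ = X + _]mul1r -banach_lim_lin.
  - congr banach_lim; apply/funext => j.
    under eq_bigr do rewrite /D mulrBr.
    by rewrite big_split /= sumrN -mulr_suml p_sum1 /D;
       rewrite -[A j.+1]/(T (A j)) /T /dual_op; ring.
  - by have [B DB] := bounded_D t; exists B => j; exact: DB.
  - have := bounded_sum (index_enum 'I_k) p (fun i => bounded_D (F i 0)).
    congr bounded_seq; apply/funext => j; under eq_bigr do rewrite /D mulrBr.
    by rewrite big_split /= sumrN -mulr_suml p_sum1 mul1r.
move=> s t; under eq_bigr do rewrite mulrBr.
by rewrite big_split /= sumrN !step; ring.
Qed.

End Stationary.

(** * Averages and finite sets of reals *)

Section Averages.
Variables (R : realType) (k : nat) (p : 'I_k -> R).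
Hypothesis p_gt0 : forall i, 0 < p i.
Hypothesis p_sum1 : \sum_(i < k) p i = 1.

Lemma average_eq_max (a : 'I_k -> R) (M : R) :
  (forall i, a i <= M) -> M <= \sum_(i < k) p i * a i -> forall i, a i = M.
Proof.
move=> aM Ma i.
have ge0 j : true -> 0 <= p j * (M - a j).
  by move=> _; rewrite mulr_ge0 ?subr_ge0// ltW.
have sum0 : \sum_(j < k) p j * (M - a j) = 0.
  apply/eqP; rewrite eq_le sumr_ge0// andbT.
  under eq_bigr do rewrite mulrBr.
  by rewrite big_split /= sumrN -mulr_suml p_sum1 mul1r subr_le0.
have /eqP := psumr_eq0P ge0 sum0 (isT : true) (i := i).
by rewrite mulf_eq0 gt_eqF//= subr_eq0 => /eqP.
Qed.

Lemma average_eq_min (a : 'I_k -> R) (m : R) :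
  (forall i, m <= a i) -> \sum_(i < k) p i * a i <= m -> forall i, a i = m.
Proof.
move=> ma am i; apply: oppr_inj.
apply: (@average_eq_max (fun i => - a i) (- m)) => [j|]; first by rewrite lerN2.
by under eq_bigr do rewrite mulrN; rewrite sumrN lerN2.
Qed.

End Averages.

Section FinitePrelim.
Variable R : realType.

Lemma finite_pos_lb (k : nat) (d : 'I_k -> R) :
  (forall i, 0 < d i) -> exists2 r, 0 < r & forall i, r <= d i.
Proof.
move=> d0; exists (\big[Num.min/1]_(i < k) d i).
  by apply: lt_bigmin => // i _.
by move=> i; exact: bigmin_le.
Qed.

Lemma seq_argmax (T : eqType) (f : T -> R) (s : seq T) (x0 : T) :
  x0 \in s -> exists2 x, x \in s & forall y, y \in s -> f y <= f x.
Proof.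
elim: s x0 => // a s IH x0 _.
case: s IH => [_|b s IH].
  by exists a; rewrite ?mem_head// => y; rewrite inE => /eqP ->.
have [x xs xmax] := IH b (mem_head _ _).
have [ax|xa] := leP (f a) (f x).
  exists x; first by rewrite inE xs orbT.
  by move=> y; rewrite inE => /orP[/eqP ->//|/xmax].
exists a; first exact: mem_head.
move=> y; rewrite inE => /orP[/eqP ->//|/xmax yx].
exact: le_trans (ltW xa).
Qed.

(** Cutting [m, M] into intervals of length c puts the values of H at distinct
    points of A into distinct pieces. *)
Lemma separated_finite (A : set R) (H : R -> R) (c m M : R) : 0 < c ->
  (forall a b, A a -> A b -> a < b -> c <= H b - H a) ->
  (forall a, A a -> m <= H a <= M) -> finite_set A.
Proof.
move=> c0 sep mM.
pose f a := Num.truncn ((H a - m) / c).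
have fE a : A a -> (f a)%:R * c <= H a - m < (f a).+1%:R * c.
  move=> Aa; rewrite -ler_pdivlMr// -ltr_pdivrMr//.
  apply: truncn_itv; rewrite divr_ge0 ?(ltW c0)// subr_ge0.
  by have /andP[] := mM _ Aa.
have lt_f a b : A a -> A b -> a < b -> f a <> f b.
  move=> Aa Ab ab fab; have := sep _ _ Aa Ab ab.
  have /andP[a1 a2] := fE _ Aa; have /andP[b1 b2] := fE _ Ab.
  by move: b1 b2; rewrite -fab -natr1 mulrDl; lra.
have fI : {in A &, injective f}.
  move=> a b /set_mem Aa /set_mem Ab fab.
  case: (ltgtP a b) => // [ab|ba]; first by case: (lt_f _ _ Aa Ab ab fab).
  by case: (lt_f _ _ Ab Aa ba (esym fab)).
apply: (@card_le_finite _ _ _ (f @` A)).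
  by rewrite (card_le_eqr (inj_card_eq fI)).
apply: (@sub_finite_set _ _ `I_((Num.truncn ((M - m) / c)).+1)) => //.
move=> _ [a Aa <-] /=; rewrite ltnS; apply: le_truncn.
by rewrite ler_pM2r ?invr_gt0// lerD2r; have /andP[] := mM _ Aa.
Qed.

End FinitePrelim.

(** * Stationary functions are continuous *)

Section Jump.
Variables (R : realType) (G : R -> R).
Hypothesis G_le : {homo G : s t / s <= t}.
Implicit Types s t u : R.

(** The size of the discontinuity of the nondecreasing function G at t. *)
Definition jump t := inf [set G (t + e) - G (t - e) | e in [set e | 0 < e]].

Let window_ge0 t e : 0 < e -> 0 <= G (t + e) - G (t - e).
Proof. by move=> e0; rewrite subr_ge0 G_le//; lra. Qed.

Let jump_has_inf t : has_inf [set G (t + e) - G (t - e) | e in [set e | 0 < e]].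
Proof.
split; first by exists (G (t + 1) - G (t - 1)), 1 => //=.
by exists 0 => _ [e /= e0 <-]; exact: window_ge0.
Qed.

Lemma jump_le s t u : s < t -> t < u -> jump t <= G u - G s.
Proof.
move=> st tu; pose e := Num.min (t - s) (u - t).
have e0 : 0 < e by rewrite lt_min !subr_gt0 st.
have es : e <= t - s by rewrite ge_min lexx.
have eu : e <= u - t by rewrite ge_min lexx orbT.
apply: (@le_trans _ _ (G (t + e) - G (t - e))).
  by apply: ge_inf; [exact: (jump_has_inf t).2|exists e].
by rewrite lerB// G_le//; lra.
Qed.

Lemma jump_window t c : jump t < c ->
  exists2 e, 0 < e & G (t + e) - G (t - e) < c.
Proof.
move=> jc; have c0 : 0 < c - jump t by rewrite subr_gt0.
have [_ [e /= e0 <-]] := inf_adherent c0 (jump_has_inf t).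
by move=> h; exists e => //; lra.
Qed.

Lemma jump_degree_one (n : int) t : degree_one G -> jump (t + n%:~R) = jump t.
Proof.
move=> G1; rewrite /jump; congr (inf (_ @` _)); apply/funext => e.
by rewrite [t + _ + e]addrAC [t + _ - e]addrAC !(degree_oneDz G1); ring.
Qed.

(** A window with a small increment bounds the variation of G near t. *)
Lemma jump0_continuous : (forall t, jump t <= 0) -> continuous G.
Proof.
move=> J0 t; apply/cvgrPdist_lt => e e0.
have [d d0 Gd] := jump_window (le_lt_trans (J0 t) e0).
near=> s.
have : `|t - s| < d by near: s; exact: cvgr_dist_lt.
rewrite ltr_norml => /andP[ds sd].
have s1 : G s <= G (t + d) by apply: G_le; lra.
have s2 : G (t - d) <= G s by apply: G_le; lra.
have t1 : G t <= G (t + d) by apply: G_le; lra.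
have t2 : G (t - d) <= G t by apply: G_le; lra.
by rewrite ltr_norml; apply/andP; split; lra.
Unshelve. all: by end_near. Qed.

(** The left limit of G increases by at least c between two points whose jump is
    at least c, because the jump at the first one lies strictly before the
    second one. *)
Lemma finite_jump c : 0 < c -> finite_set [set t | 0 <= t < 1 /\ c <= jump t].
Proof.
(* H t is the left limit of G at t. *)
move=> c0; pose H t := sup [set G s | s in [set s | s < t]].
have H_has_sup t : has_sup [set G s | s in [set s | s < t]].
  split; first by exists (G (t - 1)), (t - 1) => //=; lra.
  by exists (G t) => _ [s /= st <-]; apply/G_le/ltW.
have H_ge s t : s < t -> G s <= H t.
  by move=> st; apply: ub_le_sup; [exact: (H_has_sup t).2|exists s].
have H_le t m : (forall s, s < t -> G s <= m) -> H t <= m.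
  move=> h; apply: ge_sup; first exact: (H_has_sup t).1.
  by move=> _ [s /= st <-]; exact: h.
apply: (@separated_finite _ _ H c (G (-1)) (G 1)) => //.
  move=> a b [_ ca] [_ cb] ab.
  have Hm : G ((a + b) / 2) <= H b by apply: H_ge; lra.
  suff : H a <= G ((a + b) / 2) - c by lra.
  apply: H_le => s sa; have : jump a <= G ((a + b) / 2) - G s.
    by apply: jump_le; lra.
  lra.
move=> a [/andP[a0 a1] _]; apply/andP; split; first by apply: H_ge; lra.
by apply: H_le => s sa; apply: G_le; lra.
Qed.

End Jump.

Section StationaryContinuous.
Variables (R : realType) (k : nat) (p : 'I_k -> R).
Hypothesis p_gt0 : forall i, 0 < p i.
Hypothesis p_sum1 : \sum_(i < k) p i = 1.
Variables (h : 'I_k -> circle R -> circle R) (F K : 'I_k -> R -> R).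
Hypothesis F_lt : forall i, {homo F i : s t / s < t}.
Hypothesis KK : forall i, cancel (K i) (F i).
Hypothesis F_proj : forall i t, h i (circle_proj t) = circle_proj (F i t).
Hypothesis no_finite : forall E : set (circle R), finite_set E ->
  (forall i x, E x -> E (h i x)) -> E = set0.
Variable G : R -> R.
Hypothesis G_le : {homo G : s t / s <= t}.
Hypothesis G_degree : degree_one G.
Hypothesis G_stationary : stationary p F G.

Let F_ltE i s t : (F i s < F i t) = (s < t).
Proof.
by apply: leW_mono; apply: le_mono; exact: F_lt.
Qed.

(** Windows around the points F i t pull back to windows around t, and finitely
    many of them contain a common one, on which stationarity applies. *)
Lemma jump_subharmonic t : jump G t <= \sum_(i < k) p i * jump G (F i t).
Proof.
apply/ler_addgt0Pr => e e0.
have win i : exists2 d, 0 < d & G (F i t + d) - G (F i t - d) < jump G (F i t) + e.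
  by apply: jump_window => //; rewrite ltrDl.
pose d i := projT1 (cid2 (win i)).
have d0 i : 0 < d i by rewrite /d; case: cid2.
have Gd i : G (F i t + d i) - G (F i t - d i) < jump G (F i t) + e.
  by rewrite /d; case: cid2.
have up i : t < K i (F i t + d i) by rewrite -(F_ltE i) KK ltrDl.
have dn i : K i (F i t - d i) < t by rewrite -(F_ltE i) KK; have := d0 i; lra.
have [r r0 rE] : exists2 r, 0 < r & forall i, r <= Num.min (K i (F i t + d i) - t)
    (t - K i (F i t - d i)).
  by apply: finite_pos_lb => i; rewrite lt_min !subr_gt0 up dn.
apply: (@le_trans _ _ (G (t + r) - G (t - r))); first by apply: jump_le => //; lra.
rewrite -G_stationary -[e]mul1r -p_sum1 mulr_suml -big_split /=.
apply: ler_sum => i _; rewrite -mulrDr ler_wpM2l ?(ltW (p_gt0 i))//.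
apply: le_trans (ltW (Gd i)); have := rE i; rewrite le_min => /andP[r1 r2].
have F_le := ltW_homo (@F_lt i).
apply: lerB; apply: G_le.
  by rewrite -(@KK i (F i t + d i)); apply: F_le; lra.
by rewrite -(@KK i (F i t - d i)); apply: F_le; lra.
Qed.

(** Maximum principle: if G jumps somewhere, the jump attains its maximum,
    because it exceeds a positive level at finitely many points of the circle
    only. By subharmonicity, a point of maximal jump is sent by every map to
    points of maximal jump, so that these points form a finite nonempty
    forward invariant set. *)
Lemma stationary_continuous : continuous G.
Proof.
apply: jump0_continuous => // t0; rewrite leNgt; apply/negP => J0.
pose j (x : circle R) := jump G (circle_val x).
have jE t : j (circle_proj t) = jump G t.
  by rewrite /j /= -mulrNz jump_degree_one.
have finJ c : 0 < c -> finite_set [set x | c <= j x].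
  move=> c0; apply: sub_finite_set (finite_image (@circle_proj R) (finite_jump G_le c0)).
  move=> x cx; exists (circle_val x); last exact: circle_valK.
  by split=> //; exact: circle_val_itv.
have [x j0x xmax] : exists2 x, jump G t0 <= j x &
    forall y, jump G t0 <= j y -> j y <= j x.
  have /finite_seqP [s sE] := finJ _ J0.
  have mem_s y : (y \in s) = (jump G t0 <= j y).
    have e := congr1 (fun A => A y) sE; rewrite /= in e.
    by apply/idP/idP; rewrite e.
  have t0s : circle_proj t0 \in s by rewrite mem_s jE.
  have [x xs xm] := seq_argmax j t0s.
  by exists x; [rewrite -mem_s|move=> y; rewrite -mem_s; exact: xm].
have {}xmax y : j y <= j x.
  have [/xmax//|yj] := leP (jump G t0) (j y).
  by rewrite (le_trans (ltW yj)).
have jx0 : 0 < j x by exact: lt_le_trans j0x.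
have : [set y | j y = j x] = set0.
  apply: no_finite; first by apply: sub_finite_set (finJ _ jx0) => y /= ->.
  move=> i y /= yx; rewrite -(circle_valK y) F_proj jE.
  apply: (average_eq_max p_gt0 p_sum1 (a := fun i => jump G (F i (circle_val y)))).
    by move=> l; rewrite -jE.
  by rewrite -yx; exact: jump_subharmonic.
by move=> /seteqP [/(_ x erefl)].
Qed.

End StationaryContinuous.

(** * Lifts of homeomorphisms and growth of stationary functions *)

Section Lifts.
Variable R : realType.

Lemma circle_lift_near_at (t : R) (y : circle R) :
  exists2 u, circle_proj u = y & `|t - u| <= mdist (circle_proj t) y.
Proof.
have [u uy ut] := circle_lift_near (circle_proj t) y.
exists (u + (Num.floor t)%:~R); first by rewrite circle_projDz.
by rewrite (_ : t - _ = circle_val (circle_proj t) - u)//=; ring.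
Qed.

(** The inverse lift is part of the data: it lifts the inverse map. *)
Record circle_lift (h : homeo (circle R)) (F K : R -> R) : Prop := CircleLift {
  lift_continuous : continuous F ;
  lift_lt : {homo F : s t / s < t} ;
  lift_degree : degree_one F ;
  liftK : cancel F K ;
  lift_invK : cancel K F ;
  lift_proj : forall t, h (circle_proj t) = circle_proj (F t) }.

(** A lift is onto because h is: every t is a value of F up to an integer, which
    degree one moves into the argument. *)
Lemma exists_circle_lift (h : homeo (circle R)) :
  orientation_preserving h -> exists F K, circle_lift h F K.
Proof.
move=> [F [Fc Fm F1 Fp]].
have surj t : exists s, F s = t.
  have : circle_proj (F (circle_val (homeo_inv h (circle_proj t)))) = circle_proj t.
    by rewrite -Fp circle_valK homeo_invK.
  move=> /circle_proj_eq [n tE].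
  by exists (circle_val (homeo_inv h (circle_proj t)) + n%:~R); rewrite degree_oneDz.
have [K FK] := choice surj.
exists F, K; split=> // t; apply: (inc_inj (le_mono Fm)); exact: FK.
Qed.

Section LiftTheory.
Variables (h : homeo (circle R)) (F K : R -> R) (hF : circle_lift h F K).

Lemma lift_le : {homo F : s t / s <= t}.
Proof. exact: (ltW_homo (lift_lt hF)). Qed.

Lemma lift_inv_lt : {homo K : s t / s < t}.
Proof.
move=> s t st; rewrite ltNge; apply/negP => /lift_le.
by rewrite !(lift_invK hF) leNgt st.
Qed.

Lemma lift_inv_degree : degree_one K.
Proof.
by move=> t; rewrite -[RHS](liftK hF) (lift_degree hF) (lift_invK hF).
Qed.

Lemma lift_inv_proj t : homeo_inv h (circle_proj t) = circle_proj (K t).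
Proof. by rewrite -{1}(lift_invK hF t) -(lift_proj hF) homeo_funK. Qed.

End LiftTheory.
End Lifts.

Section StrictlyIncreasing.
Variables (R : realType) (k : nat) (p : 'I_k -> R).
Hypothesis p_gt0 : forall i, 0 < p i.
Variables (g : 'I_k -> homeo (circle R)) (F K : 'I_k -> R -> R).
Hypothesis lift_g : forall i, circle_lift (g i) (F i) (K i).
Hypothesis ginv_minimal : acts_minimally (fun i => homeo_inv (g i)).
Variable G : R -> R.
Hypothesis G_le : {homo G : s t / s <= t}.
Hypothesis G_degree : degree_one G.
Hypothesis G_stationary : stationary p F G.
Implicit Types s t u : R.

(** The support of the measure with distribution function G, lifted to the
    line. *)
Definition growth_point t := forall e, 0 < e -> G (t - e) < G (t + e).

Lemma growth_point_between s t u : growth_point u -> s < u < t -> G s < G t.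
Proof.
move=> gu /andP[su ut]; pose e := Num.min (u - s) (t - u).
have e0 : 0 < e by rewrite lt_min !subr_gt0 su.
have es : e <= u - s by rewrite ge_min lexx.
have et : e <= t - u by rewrite ge_min lexx orbT.
by rewrite (@le_lt_trans _ _ (G (u - e))) ?(lt_le_trans (gu _ e0))//; apply: G_le; lra.
Qed.

Lemma growth_pointDz t (n : int) : growth_point t -> growth_point (t + n%:~R).
Proof.
move=> gt e e0; rewrite [t + _ + e]addrAC [t + _ - e]addrAC.
by rewrite !(degree_oneDz G_degree) ltrD2r gt.
Qed.

(** If G were constant around K i t, stationarity would write 0 as an average of
    the nonnegative increments of G between images, so that G would be constant
    around F i (K i t) = t. *)
Lemma growth_point_inv i t : growth_point t -> growth_point (K i t).
Proof.
move=> gt e e0; rewrite lt_neqAle G_le ?andbT; last by lra.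
apply/eqP => Ge.
have ge0 j : true -> 0 <= p j * (G (F j (K i t + e)) - G (F j (K i t - e))).
  move=> _; rewrite mulr_ge0 ?(ltW (p_gt0 j))// subr_ge0.
  by apply/G_le/(lift_le (lift_g j)); lra.
have sum0 : \sum_(j < k) p j * (G (F j (K i t + e)) - G (F j (K i t - e))) = 0.
  by rewrite G_stationary Ge subrr.
have /eqP := psumr_eq0P ge0 sum0 (isT : true) (i := i).
rewrite mulf_eq0 gt_eqF//= subr_eq0 => /eqP Gi.
suff : G (F i (K i t - e)) < G (F i (K i t + e)) by rewrite Gi ltxx.
apply: (growth_point_between gt).
rewrite -{2 3}(lift_invK (lift_g i) t).
by apply/andP; split; apply: (lift_lt (lift_g i)); lra.
Qed.

(** The supremum of the points where G does not exceed G 0 is one: G exceeds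
    G 0 after it and does not before it. *)
Lemma exists_growth_point : exists t, growth_point t.
Proof.
pose S := [set u | G u <= G 0].
have supS : has_sup S.
  split; first by exists 0; exact: (lexx (G 0)).
  exists 1 => u; rewrite /S /= => u0; rewrite leNgt; apply/negP => u1.
  by have := G_le (ltW u1); have := G_degree 0; rewrite add0r; lra.
exists (sup S) => e e0; apply: (@le_lt_trans _ _ (G 0)).
  have [u /= Su ue] := sup_adherent e0 supS.
  by apply: le_trans Su; apply/G_le/ltW.
rewrite ltNge; apply/negP => Se.
by have := ub_le_sup supS.2 Se; lra.
Qed.

(** The orbit of a growth point under the inverse system consists of growth
    points and is dense, so that one of them lies between s and t. *)
Lemma stationary_lt : {homo G : s t / s < t}.
Proof.
move=> s t st; have [c gc] := exists_growth_point.
have orb w u : growth_point u -> exists2 v, growth_point v &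
    circle_proj v = foldl (fun z i => homeo_inv (g i) z) (circle_proj u) w.
  elim: w u => [|i w IH] u gu /=; first by exists u.
  by rewrite (lift_inv_proj (lift_g i)); apply/IH/growth_point_inv.
pose m := (s + t) / 2; pose r := (t - s) / 2.
have r0 : 0 < r by rewrite /r; lra.
have [||y [yO [w _ yw]]] := ginv_minimal (circle_proj c) (O := (ball (circle_proj m) r)^°).
- by exists (circle_proj m); exact: nbhsx_ballx.
- exact: open_interior.
have [v gv vy] := orb w _ gc.
have := interior_subset yO; rewrite ballEmdist /= => my.
have [u uy mu] := circle_lift_near_at m y.
have [n un] : exists n : int, u = v + n%:~R.
  by apply: circle_proj_eq; rewrite uy yw.
apply: (@growth_point_between _ _ u); first by rewrite un; exact: growth_pointDz.
have : `|m - u| < r by exact: le_lt_trans my.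
by rewrite ltr_norml /m /r => /andP[? ?]; apply/andP; split; lra.
Qed.

End StrictlyIncreasing.

(** * Equicontinuity of the iterates and the e-property *)

Lemma equicontinuous_e_property (R : realType) (T : metricType R) (k : nat)
    (p : 'I_k -> R) (g : 'I_k -> T -> T) :
  (forall (x : T) f (e : R), is_lipschitz f -> 0 < e ->
    \forall y \near x, forall n,
      `|iter n (dual_op p g) f y - iter n (dual_op p g) f x| <= e) ->
  e_property p g.
Proof.
move=> equi x f fL.
set S := fun y => ereal_sup _.
have S_le e : 0 < e -> \forall y \near x, (0 <= S y <= e%:E)%E.
  move=> e0; apply: filterS (equi x f e fL e0) => y ye; apply/andP; split.
    apply: le_ereal_sup_tmp; exists `|f y - f x|%:E; last by rewrite lee_fin.
    by exists 0%N.
  by apply: ge_ereal_sup => _ [n _ <-]; rewrite lee_fin.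
have Sfin y e : (0 <= S y <= e%:E)%E -> S y \is a fin_num.
  by move=> /andP[S0 S1]; rewrite ge0_fin_numE// (le_lt_trans S1)// ltry.
apply/fine_cvgP; split.
  by apply: filterS (S_le 1 ltr01) => y; exact: Sfin.
apply/cvgr0Pnorm_le => e e0; apply: filterS (S_le _ e0) => y /= Sy.
have /andP[S0 S1] := Sy.
by rewrite ger0_norm ?fine_ge0// -lee_fin fineK// (Sfin _ _ Sy).
Qed.

Section Equicontinuity.
Variables (R : realType) (k : nat) (p : 'I_k -> R).
Hypothesis p_gt0 : forall i, 0 < p i.
Hypothesis p_sum1 : \sum_(i < k) p i = 1.
Variables (g : 'I_k -> circle R -> circle R) (F : 'I_k -> R -> R).
Hypothesis F_lt : forall i, {homo F i : s t / s < t}.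
Hypothesis F_proj : forall i t, g i (circle_proj t) = circle_proj (F i t).
Variable G : R -> R.
Hypothesis G_lt : {homo G : s t / s < t}.
Hypothesis G_degree : degree_one G.
Hypothesis G_continuous : continuous G.
Hypothesis G_stationary : stationary p F G.
Implicit Types s t u : R.

Let F_le i : {homo F i : s t / s <= t}.
Proof. exact: (ltW_homo (@F_lt i)). Qed.

(** By compactness: the increment of G over a segment of length e is a positive
    continuous periodic function of its left end. *)
Lemma small_gap (e : R) : 0 < e ->
  exists2 d, 0 < d & forall s t, e <= t - s -> d <= G t - G s.
Proof.
move=> e0; pose D s := G (s + e) - G s.
have D_cont : continuous D.
  move=> s; apply: cvgB; last exact: G_continuous.
  apply: (continuous_comp (f := fun s => s + e)); last exact: G_continuous.
  by apply: cvgD; [exact: cvg_id|exact: cvg_cst].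
have [c _ cmin] := EVT_min ler01 (continuous_subspaceT D_cont).
exists (D c); first by rewrite subr_gt0 G_lt//; lra.
move=> s t st.
have : D c <= D (s - (Num.floor s)%:~R).
  by apply: cmin; rewrite in_itv /=; have /andP[-> /ltW] := fracpart_itv s.
rewrite /D -mulrNz addrAC !(degree_oneDz G_degree).
have : G (s + e) <= G t by apply: (ltW_homo G_lt); lra.
lra.
Qed.

(** The heart of the proof: the gap G t - G s is preserved on average by the
    maps, so that an affine bound in the gap passes from f to its image under
    the dual operator with the same constants. *)
Lemma dual_iter_gap (f : circle R -> R) (A B : R) :
  (forall s t, s <= t ->
     `|f (circle_proj t) - f (circle_proj s)| <= A + B * (G t - G s)) ->
  forall n s t, s <= t ->
    `|iter n (dual_op p g) f (circle_proj t) - iter n (dual_op p g) f (circle_proj s)|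
      <= A + B * (G t - G s).
Proof.
move=> fAB; elim=> [//|n IH] s t st; rewrite !iterS /dual_op -sumrB.
rewrite -G_stationary -[A]mul1r -p_sum1 mulr_suml mulr_sumr -big_split /=.
apply: le_trans (ler_norm_sum _ _ _) _; apply: ler_sum => i _.
rewrite -mulrBr normrM gtr0_norm// mulrCA -mulrDr ler_pM2l// !F_proj.
exact/IH/F_le.
Qed.

(** Short segments are dealt with by the Lipschitz constant. The gap of the
    others is bounded below by [small_gap], so that a multiple of it exceeds the
    oscillation of f, which is finite because the circle is bounded. *)
Lemma lipschitz_gap (f : circle R -> R) (e : R) : is_lipschitz f -> 0 < e ->
  exists2 B, 0 <= B & forall n s t, s <= t ->
    `|iter n (dual_op p g) f (circle_proj t) - iter n (dual_op p g) f (circle_proj s)|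
      <= e + B * (G t - G s).
Proof.
move=> [L fL] e0; pose L1 := `|L| + 1.
have L1gt0 : 0 < L1 by rewrite ltr_wpDl.
have {}fL x y : `|f x - f y| <= L1 * mdist x y.
  apply: le_trans (fL x y) _; rewrite ler_wpM2r ?mdist_ge0//.
  by rewrite (le_trans (ler_norm _))// lerDl.
have [d d0 dG] := small_gap (divr_gt0 e0 L1gt0).
exists (L1 / d); first by rewrite divr_ge0// ltW.
apply: dual_iter_gap => s t st.
have G0 : 0 <= G t - G s by rewrite subr_ge0; exact: (ltW_homo G_lt).
apply: le_trans (fL _ _) _.
have [ts|ts] := leP (e / L1) (t - s).
  apply: (@le_trans _ _ L1); first by rewrite ler_piMr ?mdist_circle_le1// ltW.
  rewrite (le_trans (y := L1 / d * (G t - G s)))//; last by rewrite lerDr ltW.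
  by rewrite mulrAC -mulrA ler_peMr ?(ltW L1gt0)// ler_pdivlMr// mul1r dG.
apply: (@le_trans _ _ e); last by rewrite lerDl mulr_ge0// divr_ge0// ltW.
rewrite mulrC -ler_pdivlMr// (le_trans (mdist_circle_proj _ _))//.
by rewrite ger0_norm ?subr_ge0// ltW.
Qed.

Lemma dual_iter_equicontinuous (f : circle R -> R) (x : circle R) (e : R) :
  is_lipschitz f -> 0 < e -> \forall y \near x, forall n,
    `|iter n (dual_op p g) f y - iter n (dual_op p g) f x| <= e.
Proof.
move=> fL e0; have e20 : 0 < e / 2 by rewrite divr_gt0.
have [B B0 HB] := lipschitz_gap fL e20.
have c0 : 0 < e / 2 / (B + 1) by rewrite divr_gt0// ltr_wpDl.
have /cvgrPdist_le /(_ _ c0) := @G_continuous (circle_val x).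
move=> /nbhs_ballP [d /= d0 dG].
apply/nbhs_ballP; exists d => //= y; rewrite ballEmdist /= => xy n.
have [t yt ty] := circle_lift_near x y; rewrite -yt -[x]circle_valK.
have {}dG : B * `|G (circle_val x) - G t| <= e / 2.
  have le1 : (B + 1) * `|G (circle_val x) - G t| <= e / 2.
    rewrite mulrC -ler_pdivlMr; last lra.
    exact: (dG t (le_lt_trans ty xy)).
  by apply: le_trans le1; rewrite ler_wpM2r// lerDl.
have [xt|/ltW tx] := leP (circle_val x) t.
  have := HB n _ _ xt; move: dG; rewrite distrC ger0_norm; first lra.
  by rewrite subr_ge0; exact: (ltW_homo G_lt).
have := HB n _ _ tx; rewrite distrC; move: dG; rewrite ger0_norm; first lra.
by rewrite subr_ge0; exact: (ltW_homo G_lt).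
Qed.

Lemma stationary_e_property : e_property p g.
Proof.
apply: equicontinuous_e_property => x f e fL e0.
exact: dual_iter_equicontinuous.
Qed.

(** * Continuous harmonic functions are constant *)

Hypothesis no_finite : forall E : set (circle R), finite_set E ->
  (forall i x, E x -> E (g i x)) -> E = set0.

(** By the maximum principle the maps send maxima of f to maxima and minima to
    minima. If f is not constant, consider the segments of the line that go from
    a maximum up to a minimum, and among them those of least gap. The gap being
    preserved on average, the maps send these minimal segments to minimal
    segments. Two minimal segments do not overlap, since their overlap would
    contain a segment of smaller gap; so there are finitely many of them on the
    circle, and their left ends form a finite nonempty forward invariant
    set. *)
Lemma harmonic_constant (f : circle R -> R) :
  continuous f -> (forall x, dual_op p g f x = f x) -> forall x y, f x = f y.
Proof.
move=> f_cont f_harm; pose ft t := f (circle_proj t).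
have ft_cont : continuous ft.
  move=> t; apply: (continuous_comp (f := @circle_proj R)); last exact: f_cont.
  exact: circle_proj_continuous.
have ftE x : f x = ft (circle_val x) by rewrite /ft circle_valK.
have fl t : (t - (Num.floor t)%:~R) \in `[(0 : R), 1].
  by rewrite in_itv /=; have /andP[-> /ltW] := fracpart_itv t.
have ftDz t (n : int) : ft (t + n%:~R) = ft t by rewrite /ft circle_projDz.
have ftF i t : ft (F i t) = f (g i (circle_proj t)) by rewrite F_proj.
have [a0 a01 ft_max] := EVT_max ler01 (continuous_subspaceT ft_cont).
have [b0 b01 ft_min] := EVT_min ler01 (continuous_subspaceT ft_cont).
have {}ft_max t : ft t <= ft a0.
  by rewrite -(ftDz t (- Num.floor t)) mulrNz; exact/ft_max/fl.
have {}ft_min t : ft b0 <= ft t.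
  by rewrite -(ftDz t (- Num.floor t)) mulrNz; exact/ft_min/fl.
suff ab : ft a0 <= ft b0.
  move=> x y; rewrite !ftE; apply/le_anti.
  by rewrite !(le_trans (ft_max _) (le_trans ab (ft_min _))).
rewrite leNgt; apply/negP => ab.
have stepM i t : ft t = ft a0 -> ft (F i t) = ft a0.
  move=> tM; rewrite ftF.
  apply: (average_eq_max p_gt0 p_sum1 (a := fun i => f (g i (circle_proj t)))).
    by move=> j; rewrite -ftF.
  by rewrite -tM /ft -[X in X <= _]f_harm.
have stepm i t : ft t = ft b0 -> ft (F i t) = ft b0.
  move=> tm; rewrite ftF.
  apply: (average_eq_min p_gt0 p_sum1 (a := fun i => f (g i (circle_proj t)))).
    by move=> j; rewrite -ftF.
  by rewrite -tm /ft -[X in _ <= X]f_harm.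
(* Up to integer translation, a segment starts in [0, 1], and cutting off whole
   turns makes it end in [0, 2]. *)
pose P : set (R * R) := [set u | [/\ u.1 \in `[(0 : R), 1], u.2 \in `[(0 : R), 2],
  ft u.1 = ft a0, ft u.2 = ft b0 & u.1 <= u.2]].
pose gap (u : R * R) := G u.2 - G u.1.
have ft_fst : continuous (fun u : R * R => ft u.1).
  by move=> u; apply: (continuous_comp (f := fst)); [exact: cvg_fst|exact: ft_cont].
have ft_snd : continuous (fun u : R * R => ft u.2).
  by move=> u; apply: (continuous_comp (f := snd)); [exact: cvg_snd|exact: ft_cont].
have gap_cont : continuous gap.
  move=> u; apply: cvgB.
    by apply: (continuous_comp (f := snd)); [exact: cvg_snd|exact: G_continuous].
  by apply: (continuous_comp (f := fst)); [exact: cvg_fst|exact: G_continuous].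
have P_compact : compact P.
  have -> : P = ([set` `[(0 : R), 1]] `*` [set` `[(0 : R), 2]]) `&`
      (((fun u : R * R => ft u.1) @^-1` [set ft a0] `&`
        (fun u : R * R => ft u.2) @^-1` [set ft b0]) `&`
       (fun u : R * R => u.2 - u.1) @^-1` [set t | 0 <= t]).
    rewrite predeqE => u; split.
      by move=> [? ? ? ? ?]; do 4?split => //=; rewrite subr_ge0.
    by move=> [[? ?] [[? ?] /=]]; rewrite subr_ge0; split.
  apply: compact_closedI; first by apply: compact_setX; exact: segment_compact.
  apply: closedI; first apply: closedI.
  - by apply: closed_comp; [move=> u _; exact: ft_fst|exact: closed_eq].
  - by apply: closed_comp; [move=> u _; exact: ft_snd|exact: closed_eq].
  - apply: closed_comp; last exact: closed_ge.
    by move=> u _; apply: cvgB; [exact: cvg_snd|exact: cvg_fst].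
have P_neq0 : P !=set0.
  exists (a0, b0 + 1); move: a01 b01; rewrite !in_itv /= => /andP[? ?] /andP[? ?].
  by split=> //=; rewrite ?in_itv /= ?(ftDz b0 1) //; lra.
have [u0 /set_mem [_ _ u0M u0m u0le] gap_min] :=
  compact_EVT_min P_neq0 P_compact (continuous_subspaceT gap_cont).
have gap0 : 0 < gap u0.
  rewrite subr_gt0 G_lt// lt_neqAle u0le andbT; apply/eqP => e.
  by move: ab; rewrite -u0M -u0m e ltxx.
have {}gap_min a b : ft a = ft a0 -> ft b = ft b0 -> a < b -> gap u0 <= G b - G a.
  move=> aM bm ltab; pose n := Num.floor a.
  have := fracpart_itv a; rewrite -/n; set a' := a - _ => /andP[a'0 a'1].
  have a'M : ft a' = ft a0 by rewrite /a' -mulrNz ftDz.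
  pose b' := b - n%:~R.
  have b'm : ft b' = ft b0 by rewrite /b' -mulrNz ftDz.
  have ltab' : a' < b' by rewrite ltrD2r.
  have -> : G b - G a = G b' - G a'.
    by rewrite /a' /b' -mulrNz !(degree_oneDz G_degree); ring.
  have [b'2|b'2] := leP b' 2.
    apply: (gap_min (a', b')); apply/mem_set; split=> //=; rewrite ?in_itv /=; lra.
  (* The representative of b' in [1, 2[ comes before b' and after a'. *)
  pose b1 := b' - (Num.floor b')%:~R + 1.
  have b1m : ft b1 = ft b0.
    by rewrite /b1 (ftDz _ 1) -mulrNz ftDz.
  have /andP[b10 b11] := fracpart_itv b'.
  have : gap u0 <= G b1 - G a'.
    by apply: (gap_min (a', b1)); apply/mem_set; split=> //=; rewrite ?in_itv /= /b1; lra.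
  have : G b1 <= G b' by apply: (ltW_homo G_lt); rewrite /b1; lra.
  lra.
(* Left ends of segments of least gap. *)
pose A t := exists2 b, t < b &
  [/\ ft t = ft a0, ft b = ft b0 & G b - G t = gap u0].
have A_proj t : A t -> A (circle_val (circle_proj t)).
  move=> [b tb [tM bm bt]]; exists (b - (Num.floor t)%:~R); first by rewrite ltrD2r.
  by rewrite /= -mulrNz !ftDz !(degree_oneDz G_degree); split=> //; rewrite -bt; ring.
have : [set x | A (circle_val x)] = set0.
  apply: no_finite.
    have finA : finite_set [set t | 0 <= t < 1 /\ A t].
      apply: (@separated_finite _ _ G (gap u0) (G 0) (G 1)) => //.
        move=> a a' [_ [b ltab [aM bm gab]]] [_ [b' ltab' [aM' bm' gab']]] aa'.
        have [ba'|a'b] := leP b a'.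
          by have := ltW_homo G_lt ba'; lra.
        by have := gap_min _ _ aM' bm a'b; have := G_lt aa'; lra.
      by move=> a [/andP[a_0 /ltW a_1] _]; rewrite !(ltW_homo G_lt).
    apply: sub_finite_set (finite_image (@circle_proj R) finA) => x Ax.
    by exists (circle_val x); [split=> //; exact: circle_val_itv|exact: circle_valK].
  move=> i x [b xb [xM bm bx]] /=; rewrite -(circle_valK x) F_proj; apply: A_proj.
  exists (F i b); first exact: F_lt.
  split; [exact: stepM|exact: stepm|].
  apply: (average_eq_min p_gt0 p_sum1
    (a := fun i => G (F i b) - G (F i (circle_val x)))).
    by move=> j; apply: gap_min; [exact: stepM|exact: stepm|exact: F_lt].
  by rewrite G_stationary bx.
move/seteqP => [/(_ (circle_proj u0.1)) + _]; apply; apply: A_proj.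
exists u0.2 => //; move: gap0; rewrite subr_gt0 => h.
by rewrite ltNge; apply/negP => /(ltW_homo G_lt); rewrite leNgt h.
Qed.

End Equicontinuity.

(** * The image of a measure under the Markov operator *)

(** The measure structure of a pushforward depends on a proof of measurability,
    which is made an explicit argument. *)
Definition pushforward_measure (d d' : measure_display) (T : measurableType d)
  (T' : measurableType d') (R : realType) (mu : {measure set T -> \bar R})
  (f : T -> T') (mf : measurable_fun setT f) : {measure set T' -> \bar R}.
Proof. by refine (pushforward mu f : {measure set T' -> \bar R}); exact: mf. Defined.

Section MarkovMeasure.
Context {d : measure_display} {T : measurableType d} {R : realType}.
Variables (k : nat) (p : 'I_k -> R) (p_ge0 : forall i, 0 <= p i).
Variables (g : 'I_k -> T -> T) (mg : forall i, measurable_fun setT (g i)).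
Variable mu : {measure set T -> \bar R}.

Let term (n : nat) : {measure set T -> \bar R} :=
  if insub n is Some i then mscale (NngNum (p_ge0 i)) (pushforward_measure mu (mg i))
  else mzero.

(** Finite sums of measures are indexed by nat, whence the zero measure beyond
    the k maps. *)
Definition markov_measure : {measure set T -> \bar R} := msum term k.

Lemma markov_measureE A : markov_measure A = markov_op p g mu A.
Proof.
rewrite /markov_measure /= /msum /markov_op; apply: eq_bigr => i _.
by rewrite /term valK.
Qed.

(** The duality between the operators on measures and on functions. *)
Lemma ge0_integral_markov_measure (f : T -> R) :
  measurable_fun setT f -> (forall x, 0 <= f x) ->
  (\int[markov_measure]_x (f x)%:E = \int[mu]_x (dual_op p g f x)%:E)%E.
Proof.
move=> mf f0.
have mfE : measurable_fun setT (fun x => (f x)%:E : \bar R).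
  exact/measurable_EFinP.
have f0E x : (0 <= (f x)%:E)%E by rewrite lee_fin.
rewrite ge0_integral_measure_sum//.
under [RHS]eq_integral do rewrite /dual_op -sumEFin.
have mgf i : measurable_fun setT (fun x => (f (g i x))%:E).
  by apply/measurable_EFinP; exact: (measurableT_comp mf (mg i)).
rewrite ge0_integral_sum//; last 2 first.
- move=> i; apply/measurable_EFinP; apply: measurable_funM => //.
  exact: (measurableT_comp mf (mg i)).
- by move=> i x _; rewrite lee_fin mulr_ge0.
apply: eq_bigr => i _; rewrite /term valK ge0_integral_mscale//=.
rewrite (ge0_integral_pushforward (mg i))//=.
under [RHS]eq_integral do rewrite EFinM.
by rewrite ge0_integralZl// lee_fin.
Qed.

Lemma invariant_ge0_integral (f : T -> R) : invariant_measure p g mu ->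
  measurable_fun setT f -> (forall x, 0 <= f x) ->
  (\int[mu]_x (dual_op p g f x)%:E = \int[mu]_x (f x)%:E)%E.
Proof.
move=> inv mf f0; rewrite -ge0_integral_markov_measure//.
by apply: eq_measure_integral => A mA _; rewrite markov_measureE inv.
Qed.

End MarkovMeasure.

Section CircleMeasurable.
Variable R : realType.

Lemma circle_continuous_measurable (f : circle R -> R) :
  continuous f -> measurable_fun setT f.
Proof.
move=> /continuousP cf; apply: (measurability _ (RGenOpens.measurableE R)).
move=> _ [_ [a [b ->] <-]]; rewrite setTI; apply: sub_sigma_algebra.
exact/cf/interval_open.
Qed.

Lemma homeo_measurable (h : homeo (circle R)) :
  measurable_fun setT (h : circle R -> circle R).
Proof.
apply: (measurability _ (erefl : measurable = <<s @open (circle R) >>)).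
move=> _ [A oA <-]; rewrite setTI; apply: sub_sigma_algebra.
by have /continuousP := @homeo_fun_continuous _ h; exact.
Qed.

Lemma circle_proj_measurable :
  measurable_fun setT (@circle_proj R : measurableTypeR R -> circle R).
Proof.
apply: (measurability _ (erefl : measurable = <<s @open (circle R) >>)).
move=> _ [A oA <-]; rewrite setTI; apply: open_measurable.
by have /continuousP := @circle_proj_continuous R; exact.
Qed.

End CircleMeasurable.

(** * Integrals against invariant probabilities *)

Lemma compact_circle (R : realType) : compact [set: circle R].
Proof.
have -> : [set: circle R] = (@circle_proj R) @` [set` `[(0 : R), 1]].
  rewrite predeqE => x; split=> // _; exists (circle_val x); last exact: circle_valK.
  by rewrite /= in_itv /=; have /andP[-> /ltW] := circle_val_itv x.
apply: continuous_compact; last exact: segment_compact.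
by apply: continuous_subspaceT; exact: circle_proj_continuous.
Qed.

Lemma near_continuous (R : realType) (T : topologicalType) (h : T -> R) :
  (forall x e, 0 < e -> \forall y \near x, `|h y - h x| <= e) -> continuous h.
Proof.
move=> near_h x; apply/cvgrPdist_le => e e0.
by apply: filterS (near_h x e e0) => y; rewrite distrC.
Qed.

Section ProbabilityIntegral.
Context d (T : measurableType d) (R : realType) (mu : probability T R).
Variables (h : T -> R) (m : R).
Hypothesis mh : measurable_fun setT h.

Let mhE : measurable_fun setT (fun x => (h x)%:E).
Proof. exact/measurable_EFinP. Qed.

Let integral_cst_probability : (\int[mu]_x m%:E = m%:E)%E.
Proof. by rewrite integral_cst//= probability_setT mule1. Qed.

Lemma probability_integral_le :
  (forall x, 0 <= h x <= m) -> (\int[mu]_x (h x)%:E <= m%:E)%E.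
Proof.
move=> hm; rewrite -integral_cst_probability; apply: ge0_le_integral => //.
- by move=> x _; rewrite lee_fin; case/andP: (hm x).
- by move=> x _; rewrite lee_fin; case/andP: (hm x).
Qed.

Lemma probability_integral_ge :
  0 <= m -> (forall x, m <= h x) -> (m%:E <= \int[mu]_x (h x)%:E)%E.
Proof.
move=> m0 hm; rewrite -integral_cst_probability; apply: ge0_le_integral => //.
by move=> x _; rewrite lee_fin.
Qed.

End ProbabilityIntegral.

Section InvariantIntegral.
Variables (R : realType) (k : nat) (p : 'I_k -> R) (g : 'I_k -> homeo (circle R)).
Hypothesis p_gt0 : forall i, 0 < p i.
Hypothesis p_sum1 : \sum_(i < k) p i = 1.
Let U := dual_op p (fun i => g i).
Variable f : circle R -> R.
Hypothesis f01 : forall x, 0 <= f x <= 1.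
Hypothesis f_equi : forall x (e : R), 0 < e ->
  \forall y \near x, forall n, `|iter n U f y - iter n U f x| <= e.
Hypothesis harmonic_cst : forall h : circle R -> R, continuous h ->
  (forall x, U h x = h x) -> forall x y, h x = h y.

Let Uf01 n x : 0 <= iter n U f x <= 1.
Proof.
elim: n x => [//|n IH] x; rewrite iterS; apply/andP; split.
  by apply: sumr_ge0 => i _; rewrite mulr_ge0 ?(ltW (p_gt0 i))//; case/andP: (IH (g i x)).
rewrite -p_sum1; apply: ler_sum => i _; rewrite ler_piMr ?(ltW (p_gt0 i))//.
by case/andP: (IH (g i x)).
Qed.

Let bounded_Uf x : bounded_seq (fun n => iter n U f x).
Proof. by exists 1 => n; have /andP[? ?] := Uf01 n x; rewrite ger0_norm. Qed.

(** The pointwise Banach limit of the iterates is continuous, because the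
    iterates are equicontinuous, and harmonic, because it is invariant under
    the shift. *)
Lemma cesaro_limit_constant : exists c, forall x, banach_lim (fun n => iter n U f x) = c.
Proof.
pose h x := banach_lim (fun n => iter n U f x).
exists (h (circle_proj 0)) => x; apply: harmonic_cst; last first.
  move=> y; rewrite /U /dual_op /h -banach_lim_sum//.
  by rewrite -[RHS]banach_lim_shift.
apply: near_continuous => y e e0; apply: filterS (f_equi y e0) => z yz.
exact: banach_lim_dist.
Qed.

(** Equicontinuity and compactness reduce the estimate to finitely many
    points. *)
Lemma uniform_cesaro c (e : R) : (forall x, banach_lim (fun n => iter n U f x) = c) ->
  0 < e -> exists n, forall x, `|cesaro (fun j => iter j U f x) n - c| <= e.
Proof.
move=> Lc e0; have e20 : 0 < e / 2 by lra.
pose V x := [set y | forall n, `|iter n U f y - iter n U f x| <= e / 2].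
have := @compact_circle R; rewrite compact_cover.
move=> /(_ _ setT (fun x => (V x)^°)) [|y _|D _ cov].
- by move=> x _; exact: open_interior.
- by exists y => //; exact: f_equi.
have [n nD] := banach_lim_approx (enum_fset D) e20 bounded_Uf.
exists n => x; have [z zD xz] := cov x I.
have Vx := interior_subset xz; have := nD z zD; rewrite Lc => zc.
rewrite -(subrK (cesaro (fun j => iter j U f z) n) (cesaro (fun j => iter j U f x) n)).
rewrite -addrA (le_trans (ler_normD _ _))//.
suff : `|cesaro (fun j => iter j U f x) n - cesaro (fun j => iter j U f z) n| <= e / 2.
  by move: zc; lra.
rewrite /cesaro -mulrBr normrM -sumrB ger0_norm ?invr_ge0//.
rewrite mulrC ler_pdivrMr ?ltr0n// (le_trans (ler_norm_sum _ _ _))//.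
apply: (@le_trans _ _ (\sum_(j < n.+1) (e / 2))); last first.
  by rewrite sumr_const card_ord mulr_natr.
by apply: ler_sum => j _; exact: Vx.
Qed.

(** Invariance gives every Cesaro mean of the iterates the same integral as f,
    and one of these means is uniformly close to c. *)
Lemma invariant_integral_unique : exists c : R,
  forall mu : probability (circle R) R, invariant_measure p (fun i => g i) mu ->
  (\int[mu]_x (f x)%:E)%E = c%:E.
Proof.
have [c Lc] := cesaro_limit_constant.
exists c => mu inv.
have mf : measurable_fun setT f.
  apply: circle_continuous_measurable; apply: near_continuous => x e e0.
  by apply: filterS (f_equi x e0) => y /(_ 0%N).
have mU h : measurable_fun setT h -> measurable_fun setT (U h).
  move=> mh; apply: measurable_sum => i; apply: measurable_funM => //.
  exact: (measurableT_comp mh (homeo_measurable (g i))).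
have [r intf] : exists r, (\int[mu]_x (f x)%:E = r%:E)%E.
  exists (fine (\int[mu]_x (f x)%:E)%E); rewrite fineK// ge0_fin_numE.
    by rewrite (le_lt_trans (probability_integral_le mu mf f01))// ltry.
  by apply: integral_ge0 => x _; rewrite lee_fin; case/andP: (f01 x).
have mUf n : measurable_fun setT (iter n U f) by elim: n => //= n; exact: mU.
have Uf0 n x : 0 <= iter n U f x by case/andP: (Uf01 n x).
have intU n : (\int[mu]_x (iter n U f x)%:E = \int[mu]_x (f x)%:E)%E.
  elim: n => [//|n IH]; rewrite -IH iterS.
  apply: invariant_ge0_integral => // [i|i]; first exact: ltW.
  exact: homeo_measurable.
have mUfE n : measurable_fun setT (fun x => (iter n U f x)%:E) by exact/measurable_EFinP.
pose h n x := cesaro (fun j => iter j U f x) n.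
have mh n : measurable_fun setT (h n).
  by apply: measurable_funM => //; exact: measurable_sum.
have h0 n x : 0 <= h n x by rewrite mulr_ge0 ?invr_ge0// sumr_ge0.
have int_h n : (\int[mu]_x (h n x)%:E = \int[mu]_x (f x)%:E)%E.
  have msum : measurable_fun setT (fun x => (\sum_(j < n.+1) iter j U f x)%:E).
    by apply/measurable_EFinP; exact: measurable_sum.
  rewrite /h /cesaro; under eq_integral do rewrite EFinM.
  rewrite ge0_integralZl//; last by move=> x _; rewrite lee_fin sumr_ge0.
  under eq_integral do rewrite -sumEFin.
  rewrite ge0_integral_sum// => [|j x _]; last by rewrite lee_fin.
  under eq_bigr do rewrite intU.
  rewrite intf sumEFin -EFinM sumr_const card_ord -[r *+ _]mulr_natl mulrA.
  by rewrite mulVf ?mul1r// pnatr_eq0.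
have c0 : 0 <= c.
  rewrite -(Lc (circle_proj 0)) -(banach_lim_cst 0); apply: ler_banach_lim => //.
  exact: bounded_cst.
have approx e : 0 < e -> `|r - c| <= e.
  move=> e0; have [n hn] := uniform_cesaro Lc e0.
  have {}hn x : c - e <= h n x <= c + e.
    by have := hn x; rewrite ler_norml => /andP[? ?]; apply/andP; split; rewrite /h; lra.
  have : (r%:E <= (c + e)%:E)%E.
    rewrite -intf -(int_h n); apply: probability_integral_le => // x.
    by rewrite h0; case/andP: (hn x).
  rewrite lee_fin => rle; have [ce|ce] := leP 0 (c - e).
    have : ((c - e)%:E <= r%:E)%E.
      rewrite -intf -(int_h n); apply: probability_integral_ge => // x.
      by case/andP: (hn x).
    by rewrite lee_fin ler_norml => ?; apply/andP; split; lra.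
  have r0 : (0%:E <= r%:E)%E.
    by rewrite -intf; apply: integral_ge0 => x _; rewrite lee_fin; case/andP: (f01 x).
  by move: r0; rewrite lee_fin ler_norml => ?; apply/andP; split; lra.
rewrite intf; congr (_%:E); apply/eqP; rewrite -subr_eq0 -normr_le0.
by apply/ler_addgt0Pr => e e0; rewrite add0r approx.
Qed.

End InvariantIntegral.

(** * Integrals of Lipschitz functions determine a probability *)

Lemma is_lipschitz_continuous (R : realType) (T : metricType R) (f : T -> R) :
  is_lipschitz f -> continuous f.
Proof.
move=> [L fL]; apply: near_continuous => x e e0.
have L1 : 0 < `|L| + 1 by rewrite ltr_wpDl.
apply/nbhs_ballP; exists (e / (`|L| + 1)); first by rewrite /= divr_gt0.
move=> y; rewrite ballEmdist /= metric_sym ltr_pdivlMr// => xy.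
apply: le_trans (fL y x) _; apply: le_trans (ltW xy).
rewrite mulrC ler_wpM2l ?mdist_ge0//.
by rewrite (le_trans (ler_norm _))// lerDl.
Qed.

Section DistanceToComplement.
Variables (R : realType) (T : metricType R) (O : set T).
Hypothesis O_neqT : ~` O !=set0.

Definition dist_compl (x : T) : R := inf [set mdist x z | z in ~` O].

Let dist_has_inf x : has_inf [set mdist x z | z in ~` O].
Proof.
split; first by have [z Oz] := O_neqT; exists (mdist x z), z.
by exists 0 => _ [z _ <-]; exact: mdist_ge0.
Qed.

Lemma dist_compl_ge0 x : 0 <= dist_compl x.
Proof.
by apply: lb_le_inf; [exact: (dist_has_inf x).1|move=> _ [z _ <-]; exact: mdist_ge0].
Qed.

Lemma dist_compl_out x : ~ O x -> dist_compl x = 0.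
Proof.
move=> Ox; apply/le_anti; rewrite dist_compl_ge0 andbT -(mdistxx x).
by apply: ge_inf; [exact: (dist_has_inf x).2|exists x].
Qed.

Lemma dist_compl_gt0 x : open O -> O x -> 0 < dist_compl x.
Proof.
move=> oO Ox; have /nbhs_ballP [e /= e0 eO] : nbhs x O by exact: open_nbhs_nbhs.
apply: (lt_le_trans e0); apply: lb_le_inf; first exact: (dist_has_inf x).1.
move=> _ [z Oz <-]; rewrite leNgt; apply/negP => xz; apply: Oz; apply: eO.
by rewrite ballEmdist.
Qed.

Lemma dist_compl_lipschitz x y : dist_compl x <= dist_compl y + mdist x y.
Proof.
rewrite -lerBlDr; apply: lb_le_inf; first exact: (dist_has_inf y).1.
move=> _ [z Oz <-]; rewrite lerBlDr addrC.
apply: (@le_trans _ _ (mdist x z)); last exact: metric_triangle.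
by apply: ge_inf; [exact: (dist_has_inf x).2|exists z].
Qed.

(** Lipschitz functions that increase to the indicator of an open O. *)
Definition bump_fun (n : nat) (x : T) : R := Num.min 1 (n%:R * dist_compl x).

Lemma bump_fun01 n x : 0 <= bump_fun n x <= 1.
Proof.
by rewrite /bump_fun le_min ler01 mulr_ge0 ?dist_compl_ge0//= ge_min lexx.
Qed.

Lemma bump_fun_lipschitz n : is_lipschitz (bump_fun n).
Proof.
exists n%:R => x y.
have half u v : bump_fun n u <= bump_fun n v + n%:R * mdist u v.
  have duv : n%:R * dist_compl u <= n%:R * dist_compl v + n%:R * mdist u v.
    by rewrite -mulrDr ler_wpM2l// dist_compl_lipschitz.
  have m0 : 0 <= n%:R * mdist u v by rewrite mulr_ge0// mdist_ge0.
  rewrite /bump_fun !minEle; case: ifPn; rewrite -?ltNge => h1;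
    by case: ifPn; rewrite -?ltNge => h2; lra.
have := half x y; have := half y x; rewrite metric_sym => h1 h2.
by rewrite ler_norml; apply/andP; split; lra.
Qed.

Lemma bump_fun_nd x : {homo (bump_fun ^~ x) : m n / (m <= n)%N >-> m <= n}.
Proof.
move=> m n mn; rewrite /bump_fun le_min ge_min lexx /= ge_min.
by rewrite ler_wpM2r ?ler_nat ?dist_compl_ge0// orbT.
Qed.

Lemma bump_fun_cvg x : open O -> bump_fun n x @[n --> \oo] --> (\1_O x : R).
Proof.
move=> oO; rewrite indicE; have [Ox|Ox] := pselect (O x); last first.
  rewrite memNset// (_ : (fun n => _) = fun=> 0); first exact: cvg_cst.
  by apply/funext => n; rewrite /bump_fun dist_compl_out// mulr0 min_r.
rewrite mem_set//; have d0 := dist_compl_gt0 oO Ox.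
apply: cvg_near_cst; near=> n; apply/eqP.
rewrite /bump_fun min_l// -ler_pdivrMr//.
by near: n; exact: nbhs_infty_ger.
Unshelve. all: by end_near. Qed.

End DistanceToComplement.

(** By monotone convergence along [bump_fun] the two measures agree on open
    sets, which are stable under intersection and generate the Borel sets. *)
Lemma lipschitz_integral_eq (R : realType) (mu nu : probability (circle R) R) :
  (forall f : circle R -> R, is_lipschitz f -> (forall x, 0 <= f x <= 1) ->
    (\int[mu]_x (f x)%:E = \int[nu]_x (f x)%:E)%E) ->
  forall A, measurable A -> mu A = nu A.
Proof.
move=> int_eq.
apply: (measure_unique (@open (circle R)) (fun=> setT)) => //.
- by move=> A B; exact: openI.
- by move=> _; exact: openT.
- by rewrite bigcup_const.
- move=> O oO; have [->|] := eqVneq O setT.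
    by rewrite /= !probability_setT.
  move=> OT; have nO : ~` O !=set0.
    by apply/set0P; apply: contra OT => /eqP/(congr1 setC); rewrite setCK setC0 => ->.
  have mO : measurable O by exact: sub_sigma_algebra.
  have muE (m : probability (circle R) R) :
      m O = limn (fun n => \int[m]_x (bump_fun O n x)%:E)%E.
    rewrite -[in LHS](setIT O) -integral_indic//.
    rewrite -monotone_convergence//.
    + apply: eq_integral => x _; apply/esym/cvg_lim => //.
      by apply: cvg_EFin; [exact: nearW|exact: bump_fun_cvg].
    + move=> n; apply/measurable_EFinP; apply: circle_continuous_measurable.
      by apply: is_lipschitz_continuous; exact: bump_fun_lipschitz.
    + by move=> n x _; rewrite lee_fin; case/andP: (bump_fun01 nO n x).
    + by move=> x _ m1 n1 mn; rewrite lee_fin bump_fun_nd.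
  apply: (etrans (muE mu)); apply: (etrans _ (esym (muE nu))); congr (limn _).
  apply/funext => n.
  by apply: int_eq; [exact: bump_fun_lipschitz|exact: bump_fun01].
- by move=> _; rewrite /= probability_setT ltry.
Qed.

(** * The Stieltjes measure of a function of degree one *)

Lemma measure_probability (d : measure_display) (T : measurableType d) (R : realType)
    (m : {measure set T -> \bar R}) : m setT = 1%E ->
  exists P : probability T R, forall A, P A = m A.
Proof.
move=> m1; exists (mnormalize m (dirac point)) => A.
by rewrite /= /mnormalize m1 onee_eq0 /= invr1 mule1.
Qed.

Section StieltjesCircle.
Variables (R : realType) (H : R -> R).
Hypothesis H_le : {homo H : s t / s <= t}.
Hypothesis H_continuous : continuous H.
Hypothesis H_degree : degree_one H.

Let H_right_continuous : right_continuous H.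
Proof. by move=> t; apply: right_continuousW. Qed.

Let H_cumulative : cumulative R R :=
  HB.pack_for (cumulative R R) H
    (isCumulative.Build R _ R H H_le H_right_continuous).

Definition stieltjes : {measure set (measurableTypeR R) -> \bar R} :=
  lebesgue_stieltjes_measure H_cumulative.

Lemma stieltjes_itv a b : a <= b -> stieltjes `]a, b]%classic = (H b - H a)%:E.
Proof.
move=> ab; rewrite /stieltjes /= /lebesgue_stieltjes_measure.
rewrite /measure_extension measurable_mu_extE/=; last exact: is_ocitv.
by rewrite wlength_itv_bnd.
Qed.

Lemma stieltjes_unique (nu : {measure set (measurableTypeR R) -> \bar R}) :
  (forall a b, a <= b -> nu `]a, b]%classic = (H b - H a)%:E) ->
  forall A, measurable A -> stieltjes A = nu A.
Proof.
move=> nuE; apply: lebesgue_stieltjes_measure_unique => X /ocitvP [->|[[a b] /= ab ->]].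
  by rewrite !measure0.
by rewrite nuE ?(ltW ab)// -stieltjes_itv// ltW.
Qed.

Lemma stieltjes_translation (n : int) (A : set (measurableTypeR R)) : measurable A ->
  stieltjes [set t : R | A (t + n%:~R)] = stieltjes A.
Proof.
move=> mA; pose tr (t : measurableTypeR R) : measurableTypeR R := t + n%:~R.
have mtr : measurable_fun setT tr by apply: measurable_funD.
rewrite [RHS](stieltjes_unique (nu := pushforward_measure stieltjes mtr))//.
move=> a b ab; rewrite /= /pushforward.
rewrite (_ : tr @^-1` _ = `](a - n%:~R), (b - n%:~R)]%classic); last first.
  by apply/seteqP; split=> t /=; rewrite !in_itv /= /tr => /andP[? ?]; apply/andP; split; lra.
rewrite stieltjes_itv ?lerB// -[in RHS](subrK n%:~R b) -[in RHS](subrK n%:~R a).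
by rewrite !(degree_oneDz H_degree); congr (_%:E); ring.
Qed.

(** With n the integer part of s, the part of ]s, s + 1] beyond n + 1 is the
    translate of ]n, s]. *)
Lemma stieltjes_fundamental_domain (C : set (measurableTypeR R)) (s : R) :
  measurable C -> (forall (n : int) t, C (t + n%:~R) <-> C t) ->
  stieltjes (C `&` `]s, s + 1]%classic) = stieltjes (C `&` `]0, 1]%classic).
Proof.
move=> mC Cper; pose n := Num.floor s.
have mI (a b : R) : measurable (C `&` `]a, b]%classic).
  by apply: measurableI => //; exact: measurable_itv.
have nle : n%:~R <= s := floor_le s.
have slt : s < n%:~R + 1 by rewrite -intrD1 floorD1_gt.
have shift (m : int) (a b : R) : stieltjes (C `&` `]a + m%:~R, b + m%:~R]%classic) =
    stieltjes (C `&` `]a, b]%classic).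
  rewrite -[LHS](stieltjes_translation m)//; apply: congr1.
  apply/seteqP; split=> t /=; rewrite !in_itv /= !ltrD2r !lerD2r => -[Ct ab].
    by split=> //; exact/(Cper m).
  by split=> //; exact/(Cper m).
have cut (a b c : R) : a <= b -> b <= c -> stieltjes (C `&` `]a, c]%classic) =
    (stieltjes (C `&` `]a, b]%classic) + stieltjes (C `&` `]b, c]%classic))%E.
  move=> ab bc; rewrite -measureU//.
    rewrite -setIUr -itv_bndbnd_setU//.
  rewrite setIACA setIid -subset0 => t [_ /=]; rewrite !in_itv /=.
  by move=> [/andP[_ ?] /andP[? _]]; lra.
rewrite (cut s (n%:~R + 1))//; [|exact: ltW|by rewrite lerD2r].
have -> : stieltjes (C `&` `]n%:~R + 1, s + 1]%classic) =
    stieltjes (C `&` `]n%:~R, s]%classic) by exact: (shift 1 n%:~R s).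
rewrite addeC -cut//; last exact: ltW.
by rewrite -[RHS](shift n) add0r [1 + _]addrC.
Qed.

End StieltjesCircle.

(** * Existence of an invariant probability *)

Section InvariantMeasure.
Variables (R : realType) (k : nat) (p : 'I_k -> R).
Hypothesis p_ge0 : forall i, 0 <= p i.
Variables (g : 'I_k -> homeo (circle R)) (F K : 'I_k -> R -> R).
Hypothesis lift_g : forall i, circle_lift (g i) (F i) (K i).
Variable H : R -> R.
Hypothesis H_le : {homo H : s t / s <= t}.
Hypothesis H_continuous : continuous H.
Hypothesis H_degree : degree_one H.
Hypothesis H_stationary : stationary p K H.

Let m := stieltjes H_le H_continuous.
Let FT (i : 'I_k) : measurableTypeR R -> measurableTypeR R := F i.

Let mF i : measurable_fun setT (FT i).
Proof. exact: continuous_measurable_fun (lift_continuous (lift_g i)). Qed.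

Let K_le i : {homo K i : s t / s <= t}.
Proof. exact: (ltW_homo (lift_inv_lt (lift_g i))). Qed.

Let preimage_itv i a b : F i @^-1` `]a, b]%classic = `]K i a, K i b]%classic.
Proof.
have FK := lift_invK (lift_g i).
have F_ltE s t : (F i s < F i t) = (s < t).
  by apply: leW_mono; apply: le_mono; exact: (lift_lt (lift_g i)).
have F_leE s t : (F i s <= F i t) = (s <= t).
  by apply: le_mono; exact: (lift_lt (lift_g i)).
by apply/seteqP; split=> t /=; rewrite !in_itv /= -(F_ltE (K i a)) -(F_leE t) !FK.
Qed.

(** The preimage of ]a, b] under F i is ]K i a, K i b], so that the equality on
    these intervals is the stationarity of H for the inverse lifts. *)
Lemma stieltjes_stationary A : measurable A -> markov_op p FT m A = m A.
Proof.
move=> mA; rewrite -(markov_measureE p_ge0 mF m); apply/esym.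
apply: stieltjes_unique => // a b ab.
rewrite markov_measureE /markov_op /pushforward.
under eq_bigr do rewrite preimage_itv stieltjes_itv ?K_le// -EFinM.
by rewrite sumEFin H_stationary.
Qed.

Let m01 : measurable (`]0, 1]%classic : set (measurableTypeR R)).
Proof. exact: measurable_itv. Qed.

Let circle_measure : {measure set (circle R) -> \bar R} :=
  pushforward_measure (mrestr m m01) (@circle_proj_measurable R).

(** A Borel set of the circle lifts to a periodic set of the line, whose part in
    ]0, 1] is measured. The preimage of this part under F i lies in
    ]K i 0, K i 0 + 1] instead of ]0, 1], which does not change the measure of a
    periodic set. *)
Lemma exists_invariant_measure : exists mu : probability (circle R) R,
  invariant_measure p (fun i => g i) mu.
Proof.
have [|mu muE] := @measure_probability _ _ _ circle_measure.
  rewrite /= /pushforward /mrestr preimage_setT setTI stieltjes_itv//.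
  by rewrite -[X in H X]add0r H_degree; congr (_%:E); ring.
exists mu => A mA; rewrite muE /markov_op.
pose B : set (measurableTypeR R) := @circle_proj R @^-1` A.
have mB : measurable B by rewrite -[B]setTI; exact: circle_proj_measurable.
have BE : circle_measure A = m (B `&` `]0, 1]%classic) by [].
rewrite BE -stieltjes_stationary; last exact: measurableI.
apply: eq_bigr => i _; congr (_ * _)%E; rewrite /pushforward muE.
transitivity (m ((FT i @^-1` B) `&` `]0, 1]%classic)).
  congr (m (_ `&` _)); apply/seteqP; split=> t /=;
    by rewrite /B /= (lift_proj (lift_g i)).
rewrite -(stieltjes_fundamental_domain H_le H_continuous H_degree (K i 0)).
- rewrite -(lift_inv_degree (lift_g i)) add0r preimage_setI.
  by rewrite (preimage_itv i 0 1 : FT i @^-1` _ = _).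
- by rewrite -[X in measurable X]setTI; exact: mF.
- move=> n t; rewrite /B /FT /= (degree_oneDz (lift_degree (lift_g i))).
  by rewrite circle_projDz.
Qed.

End InvariantMeasure.

(** * The e-property and the unique invariant probability *)

Theorem proposition4 (R : realType) (k : nat) (g : 'I_k -> homeo (circle R))
    (p : 'I_k -> R)
    (g_orientation : forall i, orientation_preserving (g i))
    (ginv_minimal : acts_minimally (fun i => homeo_inv (g i)))
    (p_gt0 : forall i, 0 < p i)
    (p_sum1 : \sum_(i < k) p i = 1) :
  e_property p (fun i => g i) /\
  exists2 mu : probability (circle R) R,
    invariant_measure p (fun i => g i) mu &
    forall nu : probability (circle R) R,
      invariant_measure p (fun i => g i) nu ->
      forall A, measurable A -> nu A = mu A.
Proof.
have p_ge0 i : 0 <= p i by exact: ltW.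
have [F FE] := choice (fun i => exists_circle_lift (g_orientation i)).
have [K lift_g] := choice FE.
have F_lt i := lift_lt (lift_g i).
have F_proj i := lift_proj (lift_g i).
have [G [G_le G_degree G_stationary]] := exists_stationary p_ge0 p_sum1
  (fun i => lift_le (lift_g i)) (fun i => lift_degree (lift_g i)).
have no_fwd := finite_forward_invariant_eq0 ginv_minimal.
have G_cont : continuous G := stationary_continuous p_gt0 p_sum1 F_lt
  (fun i => lift_invK (lift_g i)) F_proj no_fwd G_le G_degree G_stationary.
have G_lt := stationary_lt p_gt0 lift_g ginv_minimal G_le G_degree G_stationary.
split.
  exact: (stationary_e_property p_gt0 p_sum1 F_lt F_proj
    G_lt G_degree G_cont G_stationary).
have K_le i : {homo K i : s t / s <= t} := ltW_homo (lift_inv_lt (lift_g i)).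
have K_degree i := lift_inv_degree (lift_g i).
have [H [H_le H_degree H_stationary]] := exists_stationary p_ge0 p_sum1 K_le K_degree.
have H_cont : continuous H := stationary_continuous p_gt0 p_sum1
  (fun i => lift_inv_lt (lift_g i)) (fun i => liftK (lift_g i))
  (fun i => lift_inv_proj (lift_g i)) (finite_backward_invariant_eq0 ginv_minimal)
  H_le H_degree H_stationary.
have [mu mu_inv] :=
  exists_invariant_measure p_ge0 lift_g H_le H_cont H_degree H_stationary.
exists mu => // nu nu_inv; apply: lipschitz_integral_eq => f f_lip f01.
have equi x e := dual_iter_equicontinuous (g := fun i => g i) (e := e)
  p_gt0 p_sum1 F_lt F_proj G_lt G_degree G_cont G_stationary x f_lip.
have harm := harmonic_constant (g := fun i => g i) p_gt0 p_sum1 F_lt F_proj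
  G_lt G_degree G_cont G_stationary no_fwd.
have [c fc] := invariant_integral_unique p_gt0 p_sum1 f01 equi harm.
by rewrite !fc.
Qed.
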